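(* Let $E$ be a Hilbert $C^*$-module over a $C^*$-algebra $\mathcal{A}$. Then $$\mathrm{alg}\,\mathrm{lat}\,\mathcal{L}(E) = \mathrm{End}_{\mathcal{A}}(E).$$ In particular, $\mathrm{End}_{\mathcal{A}}(E)$ is a reflexive algebra of operators acting on $E$.
   Context: $\mathcal{A}$ is a (complex, not necessarily unital) $C^*$-algebra. A Hilbert $C^*$-module $E$ over $\mathcal{A}$ is a right $\mathcal{A}$-module equipped with an $\mathcal{A}$-valued inner product $\langle\cdot,\cdot\rangle$ (linear in the second variable, conjugate linear in the first, with $\langle x, ya\rangle = \langle x,y\rangle a$ and $\langle x,y\rangle^* = \langle y,x\rangle$) such that the norm $\|\xi\| = \|\langle \xi,\xi\rangle^{1/2}\|$ makes $E$ into a Banach space. $\mathrm{End}_{\mathcal{A}}(E)$ is the algebra of all bounded $\mathcal{A}$-module operators on $E$, i.e. bounded linear $S:E\to E$ with $S(xa)=S(x)a$ for all $x\in E$, $a\in\mathcal{A}$. A linear operator $S$ on $E$ is adjointable if for every $y\in E$ there is $y'\in E$ with $\langle Sx,y\rangle=\langle x,y'\rangle$ for all $x\in E$; $\mathcal{L}(E)$ is the algebra of all adjointable operators on $E$ (it is well known that $\mathcal{L}(E)\subseteq \mathrm{End}_{\mathcal{A}}(E)$). For a unital algebra $\mathfrak{A}$ of bounded operators on a Banach space $\mathfrak{X}$, $\mathrm{lat}\,\mathfrak{A}$ is the collection of all closed subspaces $M\subseteq\mathfrak{X}$ with $A(m)\in M$ for all $A\in\mathfrak{A}$, $m\in M$.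 For a collection $\mathfrak{L}$ of closed subspaces of $\mathfrak{X}$, $\mathrm{alg}\,\mathfrak{L}$ is the set of all bounded operators on $\mathfrak{X}$ that leave invariant each element of $\mathfrak{L}$. The algebra $\mathfrak{A}$ is reflexive if $\mathfrak{A}=\mathrm{alg}\,\mathrm{lat}\,\mathfrak{A}$. *)

(* Defs.v *)
From HB Require Import structures.
From mathcomp Require Import all_boot all_order all_algebra.
From mathcomp Require Import all_classical all_reals all_analysis.
From mathcomp Require Export complex.

Set Implicit Arguments.
Unset Strict Implicit.
Unset Printing Implicit Defensive.

Import Order.TTheory GRing.Theory Num.Theory.
Import numFieldNormedType.Exports.

Local Open Scope classical_set_scope.
Local Open Scope ring_scope.
Local Open Scope complex_scope.

(* C*-algebras need not be unital, so the product is not taken from the ring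
   hierarchy of the library, whose rings all have a unit. *)
HB.mixin Record CompleteNormedModule_isCStarAlgebra (R : realType) A
    of CompleteNormedModule R[i] A := {
  cmul : A -> A -> A;
  cstar : A -> A;
  cmulA : associative cmul;
  cmulDl : forall a b c : A, cmul (a + b) c = cmul a c + cmul b c;
  cmulDr : forall a b c : A, cmul a (b + c) = cmul a b + cmul a c;
  cmulZl : forall (l : R[i]) (a b : A), cmul (l *: a) b = l *: cmul a b;
  cmulZr : forall (l : R[i]) (a b : A), cmul a (l *: b) = l *: cmul a b;
  cmul_normM : forall a b : A, `|cmul a b| <= `|a| * `|b|;
  cstarK : involutive cstar;
  cstarD : forall a b : A, cstar (a + b) = cstar a + cstar b;
  cstarZ : forall (l : R[i]) (a : A), cstar (l *: a) = l^* *: cstar a;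
  cstarM : forall a b : A, cstar (cmul a b) = cmul (cstar b) (cstar a);
  cstar_norm : forall a : A, `|cmul (cstar a) a| = `|a| ^+ 2
}.

#[short(type="cstarAlgType")]
HB.structure Definition CStarAlgebra (R : realType) :=
  {A of CompleteNormedModule R[i] A & CompleteNormedModule_isCStarAlgebra R A}.

Section positivity.
Context {R : realType} {A : cstarAlgType R}.

(* The product of the unitization A + C1, where (a, l) stands for a + l1. *)
Definition unitization_mul (u v : A * R[i]) : A * R[i] :=
  (cmul u.1 v.1 + v.2 *: u.1 + u.2 *: v.1, u.2 * v.2).

Definition unitization_invertible (u : A * R[i]) : Prop :=
  exists v, unitization_mul u v = (0, 1) /\ unitization_mul v u = (0, 1).

(* The spectrum is always computed in the unitization; if A already has a unit,
   the only possible difference is the extra point 0, which does not matter for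
   positivity. *)
Definition spectrum (a : A) : set R[i] :=
  [set l | ~ unitization_invertible (a, - l)].

(* On R[i], [0 <= l] means that l is a nonnegative real number. *)
Definition positive (a : A) : Prop :=
  cstar a = a /\ (forall l, spectrum a l -> 0 <= l).

Definition is_sqrt (a h : A) : Prop := positive h /\ cmul h h = a.

End positivity.

(* [inner_norm] says that the norm of E, for which E is complete, is
   the norm of <x, x>^(1/2). *)
HB.mixin Record CompleteNormedModule_isHilbertCStarModule (R : realType)
    (A : cstarAlgType R) E of CompleteNormedModule R[i] E := {
  ract : E -> A -> E;
  inner : E -> E -> A;
  ractDl : forall (x y : E) (a : A), ract (x + y) a = ract x a + ract y a;
  ractDr : forall (x : E) (a b : A), ract x (a + b) = ract x a + ract x b;
  ractZl : forall (l : R[i]) (x : E) (a : A), ract (l *: x) a = l *: ract x a;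
  ractZr : forall (l : R[i]) (x : E) (a : A), ract x (l *: a) = l *: ract x a;
  ractM : forall (x : E) (a b : A), ract x (cmul a b) = ract (ract x a) b;
  innerDl : forall x y z : E, inner (x + y) z = inner x z + inner y z;
  innerDr : forall x y z : E, inner x (y + z) = inner x y + inner x z;
  innerZl : forall (l : R[i]) (x y : E), inner (l *: x) y = l^* *: inner x y;
  innerZr : forall (l : R[i]) (x y : E), inner x (l *: y) = l *: inner x y;
  inner_ract : forall (x y : E) (a : A), inner x (ract y a) = cmul (inner x y) a;
  inner_star : forall x y : E, cstar (inner x y) = inner y x;
  inner_ge0 : forall x : E, positive (inner x x);
  inner_eq0 : forall x : E, inner x x = 0 -> x = 0;
  inner_norm : forall x : E, exists2 h : A, is_sqrt (inner x x) h & `|x| = `|h|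
}.

#[short(type="hilbertCStarModType")]
HB.structure Definition HilbertCStarModule (R : realType) (A : cstarAlgType R) :=
  {E of CompleteNormedModule R[i] E &
        CompleteNormedModule_isHilbertCStarModule R A E}.

Section operators.
Context {R : realType} {X : completeNormedModType R[i]}.
Implicit Types (Q : set {linear X -> X}) (L : set (set X)).

Definition bounded_operator (S : {linear X -> X}) : Prop :=
  exists M : R[i], forall x, `|S x| <= M * `|x|.

Definition closed_subspace (M : set X) : Prop :=
  [/\ closed M, M 0 & forall (l : R[i]) x y, M x -> M y -> M (l *: x + y)].

Definition invariant_under (S : {linear X -> X}) (M : set X) : Prop :=
  forall m, M m -> M (S m).

Definition lat Q : set (set X) :=
  [set M | closed_subspace M /\ (forall S, Q S -> invariant_under S M)].

Definition alg L : set {linear X -> X} :=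
  [set S | bounded_operator S /\ (forall M, L M -> invariant_under S M)].

Definition unital_operator_algebra Q : Prop :=
  [/\ (forall S, Q S -> bounded_operator S),
      Q (idfun : {linear X -> X}),
      (forall S T, Q S -> Q T -> Q (S \+ T : {linear X -> X})),
      (forall (l : R[i]) S, Q S -> Q (l \*: S : {linear X -> X})) &
      (forall S T, Q S -> Q T -> Q (S \o T : {linear X -> X}))].

Definition reflexive_operator_algebra Q : Prop :=
  unital_operator_algebra Q /\ Q = alg (lat Q).

End operators.

Section module_operators.
Context {R : realType} {A : cstarAlgType R}.
Variable E : hilbertCStarModType A.

Definition EndA : set {linear E -> E} :=
  [set S | bounded_operator S /\
           (forall (x : E) (a : A), S (ract x a) = ract (S x) a)].

Definition adjointable (S : {linear E -> E}) : Prop :=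
  forall y : E, exists y' : E, forall x : E,
    inner (S x) y = inner x y' :> A.

Definition adjointable_operators : set {linear E -> E} :=
  [set S | adjointable S].

End module_operators.

Arguments EndA {R A} E.
Arguments adjointable_operators {R A} E.

(* Main.v *)
From HB Require Import structures.
Require Import Defs.
From mathcomp Require Import all_boot all_order all_algebra.
From mathcomp Require Import all_classical all_reals all_analysis.
From mathcomp Require Import ring lra zify.
Set Implicit Arguments.
Unset Strict Implicit.
Unset Printing Implicit Defensive.
Import Order.TTheory GRing.Theory Num.Theory.
Import numFieldNormedType.Exports.
Local Open Scope classical_set_scope.
Local Open Scope ring_scope.
Local Open Scope complex_scope.

(** Write A for the C*-algebra and A~ for its unitization A + C1, acting on E
    from the right.

    Every bounded module map T leaves the subspaces M of lat L(E) invariant.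
    For m in M and any x, y in E the operator z |-> x<y, z> lies in L(E), so
    T(z)<m, m> = T(z<m, m>) lies in M for every z. It remains to approximate m
    by vectors z<m, m> ([ract_inner_approx]): if <m, m> = h^2 with h
    self-adjoint, then |m - (mg)<m, m>| = |h(1 - g h^2)|, and the Cesaro means
    of the powers of 1 - e h^2 provide a polynomial g in h^2 that makes this
    small ([fnorm_sq_approx_unit]).

    Conversely let S be in alg lat L(E). The kernel of the right action of an
    element d of A~ is in lat L(E), so S(xc)d = 0 whenever cd = 0. Fix x and a
    self-adjoint a; the bounded bilinear map phi(c, d) = S(xc)d, restricted to
    a commutative algebra B containing a, vanishes on pairs with zero product.
    Such a map satisfies phi(a, 1) = phi(1, a) ([zero_product_balanced]), that
    is S(xa) = S(x)a. To see this, think of B as an algebra of real functions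
    of the variable a, spread over an interval of length about 3m. Let e_i be
    the tent function centred at i + 1. Writing a as a sum of unit ramps and
    removing products of functions with disjoint supports, one finds that
    phi(a, 1) - phi(1, a) is the sum of all
    phi(e_(i+1), e_i) - phi(e_i, e_(i+1)).
    The tents with indices in one residue class mod 3 are disjoint, so the
    terms with i in that class add up to phi(c', c) - phi(c, c') for two
    functions c, c' of norm at most 2. The total is thus bounded by a constant
    independent of m. But replacing a by ma multiplies the defect by m; so the
    defect is 0.

    The calculus of ramps and tents needs no spectral theory. Its only input is
    the inequality |x|^2 <= |x^2 + y^2| for commuting self-adjoint x, y, which
    is the C*-identity for x + iy. It gives square roots by an iteration, hence
    absolute values, hence the positive and negative parts of a - i; the zero
    products are algebraic consequences. The algebra B consists of the
    self-adjoint elements of the bicommutant of a in A~, with the C*-norm of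
    A~. *)

(** * Real-valued norms *)

Section RealNorm.
Context (R : realType) (V : normedZmodType R[i]).
Implicit Types x y : V.

Definition rnorm x : R := complex.Re `|x|.

Lemma rnormE x : (rnorm x)%:C = `|x|.
Proof. by rewrite /rnorm RRe_real// normr_real. Qed.

Lemma rnorm_ge0 x : 0 <= rnorm x.
Proof. by rewrite -ler0c rnormE. Qed.

Lemma ler_rnormD x y : rnorm (x + y) <= rnorm x + rnorm y.
Proof. by rewrite -lecR rmorphD /= !rnormE ler_normD. Qed.

Lemma rnormN x : rnorm (- x) = rnorm x.
Proof. by rewrite /rnorm normrN. Qed.

Lemma ler_rnormB x y : rnorm (x - y) <= rnorm x + rnorm y.
Proof. by rewrite -(rnormN y) ler_rnormD. Qed.

Lemma rnorm_distC x y : rnorm (x - y) = rnorm (y - x).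
Proof. by rewrite -rnormN opprB. Qed.

Lemma rnorm0 : rnorm 0 = 0.
Proof. by rewrite /rnorm normr0. Qed.

Lemma rnorm_eq0_le x : rnorm x <= 0 -> x = 0.
Proof.
move=> h; apply/eqP; rewrite -normr_eq0 -rnormE.
have /eqP -> // : rnorm x == 0 by rewrite eq_le h rnorm_ge0.
Qed.

Lemma ler_rnormMn x n : rnorm (x *+ n) = n%:R * rnorm x.
Proof.
apply: complexI; rewrite rmorphM /= rmorph_nat !rnormE normrMn.
by rewrite mulr_natl.
Qed.

End RealNorm.

(** * Sequences whose increments are dominated by a convergent sequence *)

Section DominatedSequences.
Context (R : realType) (P : nat -> R) (L : R) (PL : P @ \oo --> L).

Lemma le0_of_tail (C x : R) k : (forall j, (k <= j)%N -> x <= C * (L - P j)) ->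
  x <= 0.
Proof.
move=> h; have c0 : (fun j => C * (L - P j)) @ \oo --> (0 : R).
  rewrite -[X in _ --> X](mulr0 C); apply: cvgMr.
  by rewrite -[X in _ --> X](subrr L); apply: cvgB => //; apply: cvg_cst.
rewrite -(cvg_lim _ c0)//; apply: limr_ge; first by apply/cvg_ex; exists 0.
by exists k => // j /= kj; apply: h.
Qed.

Lemma dominated_cvg_vector (V : completeNormedModType R[i]) (b : nat -> V) (C : R) :
  (forall j k, (j <= k)%N -> rnorm (b k - b j) <= C * (P k - P j)) ->
  0 <= C -> (forall j, P j <= L) ->
  exists l, forall j, rnorm (l - b j) <= C * (L - P j).
Proof.
move=> bP C0 PleL.
have small e : 0 < e -> exists K, C * (L - P K) < e.
  move=> e0; have [//|h] := pselect (exists K, C * (L - P K) < e).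
  suff : e <= 0 by rewrite leNgt e0.
  apply: (@le0_of_tail C _ 0) => j _; rewrite leNgt; apply/negP => hj.
  by apply: h; exists j.
have cb : cvg (b @ \oo).
  apply/cauchy_cvgP/cauchy_exP => -[e f] e0.
  move: e0; rewrite ltcE /= => /andP[/eqP f0 e0].
  have [K hK] := small _ e0.
  exists (b K); exists K => // k /= Kk.
  rewrite -ball_normE /= f0 -rnormE ltcE /= eqxx /=.
  rewrite rnorm_distC (le_lt_trans (bP _ _ Kk))//.
  by apply: le_lt_trans hK; apply: ler_wpM2l => //; rewrite lerD2r.
exists (lim (b @ \oo)) => j; apply/ler_addgt0Pr => e e0.
have /cvgrPdist_lt /(_ e%:C) := cb.
rewrite ltcR => /(_ e0) [K _ hK].
have := hK (maxn K j) (leq_maxl _ _) => /=.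
rewrite -rnormE ltcR => h.
have -> : lim (b @ \oo) - b j = (lim (b @ \oo) - b (maxn K j)) + (b (maxn K j) - b j).
  by rewrite addrA subrK.
rewrite (le_trans (ler_rnormD _ _))// addrC lerD ?(ltW h)//.
apply: (le_trans (bP _ _ (leq_maxr _ _))).
by apply: ler_wpM2l => //; rewrite lerD2r.
Qed.

(** The sequence r + P is nondecreasing and bounded, which reduces the claim to
    monotone convergence. *)
Lemma dominated_cvg_real (r : nat -> R) :
  (forall j k, (j <= k)%N -> `|r k - r j| <= P k - P j) -> (forall j, P j <= L) ->
  exists l, forall j, `|l - r j| <= L - P j.
Proof.
move=> rP PleL; pose s k := r k + P k.
have nd : {homo s : n m / (n <= m)%N >-> n <= m}.
  by move=> n m /rP; rewrite /s ler_norml => /andP[? _]; lra.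
have ub : has_ubound (range s).
  exists (r 0%N + L - P 0%N + L) => _ [k _ <-]; rewrite /s.
  have := rP 0%N k (leq0n _); rewrite ler_norml => /andP[_ h].
  have := PleL k; lra.
have cs := nondecreasing_is_cvgn nd ub.
pose l := lim (s @ \oo) - L.
have rl : r @ \oo --> l.
  have -> : r = (fun k => s k - P k) by apply/funext => k; rewrite /s addrK.
  exact: cvgB.
exists l => j; apply/ler_addgt0Pr => e e0.
have /cvgrPdist_lt /(_ e e0) [K _ hK] := rl.
have := hK (maxn K j) (leq_maxl _ _) => /= h.
have := rP _ _ (leq_maxr K j).
have := PleL (maxn K j).
have -> : l - r j = (l - r (maxn K j)) + (r (maxn K j) - r j) by rewrite addrA subrK.
have := ler_normD (l - r (maxn K j)) (r (maxn K j) - r j).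
lra.
Qed.

End DominatedSequences.

(** * Commutative real Banach algebras of functions *)

(** These are, up to isomorphism, the algebras of real continuous functions on a
    compact space with the supremum norm (Arens): [fnorm_sq] says that adding a
    square to a square does not decrease the norm. *)
Record is_function_norm (R : realType) (B : comNzRingType)
    (cst : {rmorphism R -> B}) (N : B -> R) : Prop := IsFunctionNorm {
  fnorm_ge0 : forall x, 0 <= N x;
  fnormD : forall x y, N (x + y) <= N x + N y;
  fnormZ : forall r x, N (cst r * x) = `|r| * N x;
  fnormM : forall x y, N (x * y) <= N x * N y;
  fnorm1 : N 1 <= 1;
  fnorm_sq : forall x y, N x ^+ 2 <= N (x ^+ 2 + y ^+ 2);
  fnorm_eq0 : forall x, N x = 0 -> x = 0;
  fnorm_complete : forall (p : nat -> B) (P : nat -> R) (L : R),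
    (forall k, N (p k.+1 - p k) <= P k.+1 - P k) -> P @ \oo --> L ->
    exists l, forall k, N (l - p k) <= L - P k
}.

(** Bernoulli's inequality, squared, makes the powers of a number greater than 1
    grow quadratically. Exponents are powers of 2 because |x^n| = |x|^n is only
    known for those. *)
Lemma le_of_pow2_le_linear (R : realType) (C x : R) : 0 <= x ->
  (forall k, x ^+ (2 ^ k) <= C * (2 ^ k).+1%:R) -> x <= 1.
Proof.
move=> x0 h; rewrite leNgt; apply/negP => x1.
pose e := x - 1; have e0 : 0 < e by rewrite /e subr_gt0.
have bern n : 1 + n%:R * e <= x ^+ n.
  elim: n => [|n IH]; first by rewrite expr0 mul0r addr0.
  rewrite exprS; apply: (@le_trans _ _ (x * (1 + n%:R * e))); last first.
    by rewrite ler_pM2l // (lt_trans ltr01).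
  have : 0 <= n%:R * e ^+ 2 by rewrite mulr_ge0// sqr_ge0.
  rewrite -natr1 /e; lra.
have C0 : 0 <= C.
  by have := h 0%N; rewrite expn0 expr1 => hh; nra.
have key k : (2 ^ k)%:R * e ^+ 2 <= 3 * C.
  have := h k.+1; rewrite expnS mulnC exprM.
  have := bern (2 ^ k)%N.
  set n := (2 ^ k)%N; set y := x ^+ n; move=> yb yh.
  have n1 : 1 <= n%:R :> R by rewrite ler1n expn_gt0.
  have : (1 + n%:R * e) ^+ 2 <= C * (n * 2).+1%:R.
    apply: le_trans yh; rewrite ler_pXn2r// ?nnegrE; first nra.
    by rewrite exprn_ge0.
  rewrite -natr1 natrM => yh2.
  have : n%:R * (n%:R * e ^+ 2) <= n%:R * (3 * C) by nra.
  by rewrite ler_pM2l // (lt_le_trans ltr01).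
have e20 : 0 < e ^+ 2 by rewrite exprn_gt0.
pose m := Num.bound (3 * C / e ^+ 2).
have hm : 3 * C / e ^+ 2 < m%:R.
  by apply: archi_boundP; rewrite divr_ge0// ?mulr_ge0// ltW.
have := key m; rewrite -ler_pdivlMr// => /le_lt_trans /(_ hm).
by rewrite ltr_nat ltnNge ltnW// ltn_expl.
Qed.

Section FunctionNorm.
Context (R : realType) (B : comNzRingType) (cst : {rmorphism R -> B})
  (N : B -> R) (HN : is_function_norm cst N).
Implicit Types (x y z u v : B) (r s : R).

Lemma fnormN x : N (- x) = N x.
Proof.
have -> : - x = cst (-1) * x by rewrite rmorphN1 mulN1r.
by rewrite (fnormZ HN) normrN1 mul1r.
Qed.

Lemma fnormB x y : N (x - y) <= N x + N y.
Proof. by rewrite -(fnormN y) (fnormD HN). Qed.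

Lemma fnorm0 : N 0 = 0.
Proof. by rewrite -(mulr0 (cst 0)) (fnormZ HN) normr0 mul0r. Qed.

Lemma fnorm_eq0_le x : N x <= 0 -> x = 0.
Proof. by move=> h; apply: (fnorm_eq0 HN); apply/eqP; rewrite eq_le h (fnorm_ge0 HN). Qed.

Lemma fnormX2 x : N (x ^+ 2) = N x ^+ 2.
Proof.
apply/eqP; rewrite eq_le expr2 [X in _ && X](_ : _ = true) ?andbT ?(fnormM HN)//.
by have := fnorm_sq HN x 0; rewrite expr0n addr0 !expr2.
Qed.

Lemma fnorm_cst r : N (cst r) <= `|r|.
Proof.
rewrite -[cst r]mulr1 (fnormZ HN); have := fnorm1 HN.
by move=> h; rewrite ler_piMr.
Qed.

Lemma fnormX_le1 x n : N x <= 1 -> N (x ^+ n) <= 1.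
Proof.
move=> x1; elim: n => [|n IH]; first by rewrite expr0 (fnorm1 HN).
rewrite exprS (le_trans (fnormM HN _ _))//.
by rewrite mulr_ile1// (fnorm_ge0 HN).
Qed.

Lemma fnorm_pow2 x k : N x ^+ (2 ^ k) = N (x ^+ (2 ^ k)).
Proof.
elim: k => [|k IH]; first by rewrite expn0 !expr1.
by rewrite expnS mulnC !exprM IH fnormX2.
Qed.

Lemma fnorm_le1_of_linear_growth (C : R) x :
  (forall n, N (x ^+ n) <= C * n.+1%:R) -> N x <= 1.
Proof.
move=> h; apply: (@le_of_pow2_le_linear R C); first exact: (fnorm_ge0 HN).
by move=> k; rewrite fnorm_pow2.
Qed.

(** With h = 1/2 these are the iterates, from 0, of p |-> (y + p^2)/2, whose
    fixed points satisfy (1 - p)^2 = 1 - y. *)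
Fixpoint sqrt_seq (T : pzRingType) (h y : T) k : T :=
  if k is k'.+1 then h * (y + sqrt_seq h y k' ^+ 2) else 0.

Lemma half_sum : 2^-1 + 2^-1 = 1 :> R. Proof. by field. Qed.

(** The increments of the iteration for y are dominated by those of the same
    iteration for the number 1, which is monotone and bounded. *)
Lemma one_sub_sqrt y : N y <= 1 -> exists2 p, N p <= 1 & (1 - p) ^+ 2 = 1 - y.
Proof.
move=> y1; pose h := cst 2^-1.
have hh : h + h = 1 by rewrite -rmorphD half_sum rmorph1.
pose P := sqrt_seq (2^-1 : R) 1; pose p := sqrt_seq h y.
have PS k : P k.+1 = 2^-1 * (1 + P k ^+ 2) by [].
have pS k : p k.+1 = h * (y + p k ^+ 2) by [].
have P01 k : 0 <= P k <= 1.
  elim: k => [|k /andP[P0 P1]]; first by rewrite lexx ler01.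
  rewrite PS; have := sqr_ge0 (P k).
  have : P k ^+ 2 <= 1 by rewrite expr_le1.
  move=> ? ?; apply/andP; split; lra.
have Pnd k : P k <= P k.+1.
  by rewrite PS; have := sqr_ge0 (1 - P k); lra.
have pP k : N (p k) <= P k.
  elim: k => [|k IH]; first by rewrite /= fnorm0.
  rewrite pS PS (fnormZ HN) ger0_norm ?invr_ge0//.
  rewrite ler_pM2l ?invr_gt0// (le_trans (fnormD HN _ _))// lerD// fnormX2.
  by rewrite ler_pXn2r// nnegrE ?(fnorm_ge0 HN)//; case/andP: (P01 k).
have dpP k : N (p k.+1 - p k) <= P k.+1 - P k.
  elim: k => [|k IH].
    rewrite pS PS -[p 0]/(0 : B) -[P 0]/(0 : R) !expr0n /= !addr0 !subr0.
    rewrite (fnormZ HN) ger0_norm ?invr_ge0//.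
    by rewrite ler_pM2l ?invr_gt0.
  have -> : p k.+2 - p k.+1 = h * ((p k.+1 + p k) * (p k.+1 - p k)).
    by rewrite (pS k.+1) [in X in _ - X]pS; ring.
  have -> : P k.+2 - P k.+1 = 2^-1 * ((P k.+1 + P k) * (P k.+1 - P k)).
    by rewrite (PS k.+1) [in X in _ - X]PS; ring.
  rewrite (fnormZ HN) ger0_norm ?invr_ge0// ler_pM2l ?invr_gt0//.
  rewrite (le_trans (fnormM HN _ _))// ler_pM// ?(fnorm_ge0 HN)//.
  by rewrite (le_trans (fnormD HN _ _))// lerD.
have ndP : {homo P : n m / (n <= m)%N >-> n <= m} by apply/nondecreasing_seqP.
have ubP : has_ubound (range P).
  by exists 1 => _ [k _ <-]; case/andP: (P01 k).
have cP := nondecreasing_is_cvgn ndP ubP.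
set L := lim (P @ \oo) in cP.
have L1 : L <= 1.
  by apply: limr_le => //; near=> k; case/andP: (P01 k).
have [l hl] := fnorm_complete HN dpP cP.
have l1 : N l <= 1.
  have := hl 0%N; rewrite /= !subr0 => /le_trans; exact.
exists l => //.
suff h0 : 2%:R * l - y - l ^+ 2 = 0.
  by apply/subr0_eq; rewrite -oppr0 -h0; ring.
apply: fnorm_eq0_le.
(* The defect of the limit is expressed through l - p_k and l - p_(k+1). *)
have bd k : N (2%:R * l - y - l ^+ 2) <= 4 * (L - P k).
  have -> : 2%:R * l - y - l ^+ 2 = (l - p k.+1) + (l - p k.+1) - (l + p k) * (l - p k).
    rewrite pS.
    transitivity (2%:R * l - (h + h) * y - l ^+ 2); first by rewrite hh mul1r.
    transitivity (2%:R * l - (h + h) * y - (h + h) * p k ^+ 2 + p k ^+ 2 - l ^+ 2).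
       by rewrite hh; ring.
    ring.
  apply: le_trans (fnormB _ _) _.
  have a1 := fnormD HN (l - p k.+1) (l - p k.+1).
  have a2 := fnormM HN (l + p k) (l - p k).
  have a3 := fnormD HN l (p k).
  have a4 := hl k.+1; have a5 := hl k.
  have a6 := pP k; have a7 := Pnd k; have a8 := P01 k.
  have a9 := fnorm_ge0 HN (l - p k).
  have a10 : N (l + p k) * N (l - p k) <= 2 * N (l - p k).
    by rewrite ler_wpM2r//; lra.
  lra.
by apply: (@le0_of_tail R P L cP 4 _ 0%N) => k _; exact: bd.
Unshelve. all: by end_near.
Qed.

(** If w^2 = 1 - x^2 then w^2 + x^2 = 1, so |w| <= 1. *)
Lemma fnorm_one_sub_sq x : N x <= 1 -> N (1 - x ^+ 2) <= 1.
Proof.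
move=> x1.
have : N (x ^+ 2) <= 1 by rewrite fnormX2 exprn_ile1// (fnorm_ge0 HN).
move=> /one_sub_sqrt[p _ hp]; rewrite -hp fnormX2.
by apply: le_trans (fnorm_sq HN _ x) _; rewrite hp subrK (fnorm1 HN).
Qed.

(** For functions this is u >= 0: take e = 1/|u|. The condition needs no
    spectrum, and a convex combination of 1 - eu and 1 - fv shows that the
    nonnegative elements form a cone. *)
Definition fpositive u := exists2 e : R, 0 < e & N (1 - cst e * u) <= 1.

Lemma cstV r : 0 < r -> cst r * cst r^-1 = 1.
Proof. by move=> r0; rewrite -rmorphM divff ?rmorph1// gt_eqF. Qed.

Lemma exists_abs x : exists2 r, fpositive r & r ^+ 2 = x ^+ 2.
Proof.
pose K := 1 + N x; have K0 : 0 < K by rewrite ltr_pwDl// (fnorm_ge0 HN).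
pose x' := cst K^-1 * x.
have x'1 : N x' <= 1.
  rewrite (fnormZ HN) ger0_norm ?invr_ge0 ?(ltW K0)// ler_pdivrMl// mulr1.
  by rewrite lerDr.
have /one_sub_sqrt[p p1 hp] := fnorm_one_sub_sq x'1.
exists (cst K * (1 - p)).
  exists K^-1; first by rewrite invr_gt0.
  by rewrite mulrA [cst K^-1 * _]mulrC cstV// mul1r opprB addrC subrK.
rewrite exprMn hp opprB addrC subrK /x' -exprMn mulrA cstV// mul1r.
by [].
Qed.

Lemma fpositiveD u v : fpositive u -> fpositive v -> fpositive (u + v).
Proof.
move=> [e e0 hu] [f f0 hv].
have ef : 0 < e + f by rewrite addr_gt0.
pose a := f / (e + f); pose b := e / (e + f).
have a0 : 0 <= a by rewrite divr_ge0// ltW.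
have b0 : 0 <= b by rewrite divr_ge0// ltW.
have ab : a + b = 1 by rewrite /a /b -mulrDl addrC divff// gt_eqF.
exists (a * e); first by rewrite mulr_gt0// divr_gt0.
have bf : b * f = a * e by rewrite /a /b; ring.
have -> : 1 - cst (a * e) * (u + v) =
    cst a * (1 - cst e * u) + cst b * (1 - cst f * v).
  transitivity (cst (a + b) - cst (a * e) * u - cst (b * f) * v).
    by rewrite ab bf rmorph1; ring.
  by rewrite rmorphD !rmorphM; ring.
rewrite (le_trans (fnormD HN _ _))// !(fnormZ HN) !ger0_norm// -ab lerD//.
  by rewrite ler_piMr.
by rewrite ler_piMr.
Qed.

Lemma fpositive_shift u s : 0 <= s -> N u <= s -> fpositive (cst s + u).
Proof.
move=> s0 us; have s1 : 0 < 1 + s by rewrite ltr_pwDl.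
exists (1 + s)^-1; first by rewrite invr_gt0.
set e := (1 + s)^-1.
have e0 : 0 < e by rewrite invr_gt0.
have es : e * s <= 1 by rewrite ler_pdivrMl// mulr1 lerDr.
have -> : 1 - cst e * (cst s + u) = cst (1 - e * s) - cst e * u.
  by rewrite rmorphB rmorph1 rmorphM; ring.
rewrite (le_trans (fnormB _ _))// (fnormZ HN) (ger0_norm (ltW e0)).
have := fnorm_cst (1 - e * s); rewrite ger0_norm ?subr_ge0// => h.
have : e * N u <= e * s by rewrite ler_pM2l.
lra.
Qed.

(** A nonnegative T has no negative eigenvalue: (1 + ek)v = (1 - eT)v has norm at
    most |v|. *)
Lemma fpositive_eigen T v k : fpositive T -> 0 < k -> T * v = - (cst k * v) ->
  v = 0.
Proof.
move=> [e e0 hT] k0 hv.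
have hv' : cst (1 + e * k) * v = (1 - cst e * T) * v.
  by rewrite mulrBl -mulrA hv rmorphD rmorph1 rmorphM; ring.
have ek : 0 < e * k by rewrite mulr_gt0.
have : N (cst (1 + e * k) * v) <= N v.
  rewrite hv' (le_trans (fnormM HN _ _))// ler_piMl// (fnorm_ge0 HN)//.
rewrite (fnormZ HN) ger0_norm ?addr_ge0// ?(ltW ek)// mulrDl mul1r gerDl.
rewrite pmulr_rle0//; exact: fnorm_eq0_le.
Qed.

(** As a function, u equals T on the set where it does not vanish. Algebraically,
    (1 - eu)^n = 1 - eu(1 + t + ... + t^(n-1)) with t = 1 - eT of norm at most 1;
    so the powers of 1 - eu grow at most linearly, which forces |1 - eu| <= 1. *)
Lemma fpositive_of_eq T u : fpositive T -> u ^+ 2 = T * u -> fpositive u.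
Proof.
move=> [e e0 hT] hu; exists e => //.
apply: (@fnorm_le1_of_linear_growth (1 + e * N u)) => n.
have uT k : u * (1 - cst e * u) ^+ k = u * (1 - cst e * T) ^+ k.
  elim: k => [//|k IH]; rewrite !exprS mulrCA IH mulrCA.
  have -> : u * ((1 - cst e * u) * (1 - cst e * T) ^+ k) =
     (u - cst e * u ^+ 2) * (1 - cst e * T) ^+ k by ring.
  by rewrite hu; ring.
elim: n => [|n IH].
  rewrite expr0 mulr1; apply: le_trans (fnorm1 HN) _.
  by rewrite lerDl mulr_ge0 ?(ltW e0) ?(fnorm_ge0 HN).
have -> : (1 - cst e * u) ^+ n.+1 =
    (1 - cst e * u) ^+ n - cst e * (u * (1 - cst e * T) ^+ n).
  by rewrite -uT exprS; ring.
rewrite (le_trans (fnormB _ _))// -[in leRHS]natr1 mulrDr mulr1 lerD//.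
rewrite (fnormZ HN) (ger0_norm (ltW e0)) ler_wpDl//.
rewrite ler_pM2l// (le_trans (fnormM HN _ _))// ler_piMr ?(fnorm_ge0 HN)//.
exact: fnormX_le1.
Qed.

Lemma fpositive_mul_sq u v : fpositive u -> fpositive v ->
  exists z, u * v = z ^+ 2.
Proof.
suff sq w : fpositive w -> exists z, w = z ^+ 2.
  by move=> /sq[y ->] /sq[z ->]; exists (y * z); rewrite exprMn.
move=> [e e0 /one_sub_sqrt[p _ hp]].
exists (cst (Num.sqrt e^-1) * (1 - p)); rewrite exprMn hp -rmorphXn /=.
rewrite sqr_sqrtr ?invr_ge0 ?(ltW e0)// opprB addrC subrK mulrA -rmorphM mulVf ?gt_eqF//.
by rewrite rmorph1 mul1r.
Qed.

(** The powers of the sum are the sums of the powers, hence bounded by n. *)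
Lemma fnorm_orthogonal_sum (u : nat -> B) n :
  (forall k, N (u k) <= 1) -> (forall k l, k != l -> u k * u l = 0) ->
  N (\sum_(k < n) u k) <= 1.
Proof.
move=> u1 u0; apply: (@fnorm_le1_of_linear_growth n.+1%:R) => m.
have [->|m0] := posnP m; last first.
  have -> : (\sum_(k < n) u k) ^+ m = \sum_(k < n) u k ^+ m.
    elim: n => [|n IH]; first by rewrite !big_ord0 expr0n gtn_eqF.
    have o : (\sum_(k < n) u k) * u n = 0.
      by rewrite mulr_suml big1// => i _; rewrite u0// ltn_eqF.
    rewrite !big_ord_recr /= -IH; case: m m0 {IH} => // m _.
    elim: m => [|m IH]; first by rewrite !expr1.
    rewrite exprS IH !mulrDl !mulrDr.
    set s := \sum_(k < n) _ in o *.
    have -> : s * u n ^+ m.+1 = 0 by rewrite exprS mulrA o mul0r.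
    have -> : u n * s ^+ m.+1 = 0 by rewrite exprS mulrA [u n * _]mulrC o mul0r.
    by rewrite addr0 add0r -!exprS.
  apply: (@le_trans _ _ n%:R).
    elim: n => [|n IH]; first by rewrite big_ord0 fnorm0.
    by rewrite big_ord_recr /= (le_trans (fnormD HN _ _))// -natr1 lerD// fnormX_le1.
  by rewrite -natrM ler_nat; nia.
rewrite expr0 mulr1 (le_trans (fnorm1 HN))// ler1n//.
Qed.


(** * Ramps and tents *)

(** Here a plays the role of the coordinate function t, and [abs i] that of
    |t - i|. *)
Section Tents.
Context (a : B) (abs : nat -> B) (abs_pos : forall i, fpositive (abs i))
  (abs_sq : forall i, abs i ^+ 2 = (a - i%:R) ^+ 2).

Let h := cst 2^-1.
Let hh : h + h = 1. Proof. by rewrite -rmorphD half_sum rmorph1. Qed.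

(** The positive and negative parts of t - i. *)
Definition ppart i := h * (abs i + (a - i%:R)).
Definition npart i := h * (abs i - (a - i%:R)).

Lemma pnpart_sub i : ppart i - npart i = a - i%:R.
Proof. by transitivity ((h + h) * (a - i%:R)); [rewrite /ppart /npart; ring|rewrite hh mul1r]. Qed.

Lemma pnpart_add i : ppart i + npart i = abs i.
Proof. by transitivity ((h + h) * abs i); [rewrite /ppart /npart; ring|rewrite hh mul1r]. Qed.

Lemma pnpart_mul i : ppart i * npart i = 0.
Proof.
transitivity (h * h * (abs i ^+ 2 - (a - i%:R) ^+ 2)); first by rewrite /ppart /npart; ring.
by rewrite abs_sq subrr mulr0.
Qed.

Lemma ppart_sq i : ppart i ^+ 2 = abs i * ppart i.
Proof. by rewrite -pnpart_add mulrDl [npart i * _]mulrC pnpart_mul addr0. Qed.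

Lemma npart_sq i : npart i ^+ 2 = abs i * npart i.
Proof. by rewrite -pnpart_add mulrDl pnpart_mul add0r. Qed.

Lemma mul_ppart i : (a - i%:R) * ppart i = ppart i ^+ 2.
Proof. by rewrite -pnpart_sub mulrBl [npart i * _]mulrC pnpart_mul subr0. Qed.

Lemma mul_npart i : (a - i%:R) * npart i = - npart i ^+ 2.
Proof. by rewrite -pnpart_sub mulrBl pnpart_mul sub0r. Qed.

Lemma ppart_pos i : fpositive (ppart i).
Proof. exact: fpositive_of_eq (abs_pos i) (ppart_sq i). Qed.

Lemma npart_pos i : fpositive (npart i).
Proof. exact: fpositive_of_eq (abs_pos i) (npart_sq i). Qed.

(** For i < j the product v satisfies |t - i|v = -(t - i)v and
    |t - j|v = (t - j)v, so v is an eigenvector of |t - i| + |t - j| for the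
    eigenvalue -(j - i); being nonnegative, this sum has none. *)
Lemma ppart_mul_npart i j : (i <= j)%N -> ppart j * npart i = 0.
Proof.
rewrite leq_eqVlt => /predU1P[->|ij]; first exact: pnpart_mul.
apply: (fpositive_eigen (fpositiveD (abs_pos i) (abs_pos j)) (k := (j - i)%N%:R)).
  by rewrite ltr0n subn_gt0.
rewrite mulrDl mulrCA -npart_sq [abs j * _]mulrA -ppart_sq.
have -> : npart i ^+ 2 = - ((a - i%:R) * npart i) by rewrite mul_npart opprK.
rewrite -mul_ppart rmorph_nat natrB ?(ltnW ij)//; ring.
Qed.

(** The function that is 0 up to i, increases linearly to 1 at i + 1, and is
    1 from there on. *)
Definition ramp i := ppart i - ppart i.+1.

Lemma one_sub_ramp i : 1 - ramp i = npart i.+1 - npart i.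
Proof.
have h1 := pnpart_sub i; have h2 := pnpart_sub i.+1.
have -> : (1 : B) = (a - i%:R) - (a - i.+1%:R) by rewrite -natr1; ring.
by rewrite -h1 -h2 /ramp; ring.
Qed.

(** With g the ramp, g(1 - g) is the product of two nonnegative elements and so a
    square y^2; then (2g - 1)^2 + (2y)^2 = 1. *)
Lemma ramp_norm i : N (ramp i) <= 1.
Proof.
have [y hy] := fpositive_mul_sq (ppart_pos i) (npart_pos i.+1).
have e4 : ramp i * (1 - ramp i) = y ^+ 2.
  rewrite one_sub_ramp /ramp !mulrBl !mulrBr hy !pnpart_mul.
  by rewrite (ppart_mul_npart (leqnSn i)) !subr0.
pose G := 2 * ramp i - 1.
have G2 : G ^+ 2 + (2 * y) ^+ 2 = 1.
  transitivity (1 - 4 * (ramp i * (1 - ramp i)) + 4 * y ^+ 2); first by rewrite /G; ring.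
  by rewrite e4; ring.
have G1 : N G <= 1.
  have := fnorm_sq HN G (2 * y); rewrite G2 => /le_trans /(_ (fnorm1 HN)).
  by rewrite expr_le1 ?(fnorm_ge0 HN).
have -> : ramp i = h * (1 + G).
  transitivity ((h + h) * ramp i); first by rewrite hh mul1r.
  by rewrite /G; ring.
rewrite (fnormZ HN) ger0_norm ?invr_ge0//.
have := fnormD HN 1 G; have := fnorm1 HN; lra.
Qed.

(** The tent supported in [i, i + 2]. *)
Definition tent i := ramp i - ramp i.+1.

Lemma tent_norm i : N (tent i) <= 2.
Proof.
apply: le_trans (fnormB _ _) _.
by have := ramp_norm i; have := ramp_norm i.+1; lra.
Qed.

Lemma ramp_orthogonal i j : (i < j)%N -> ramp j * (1 - ramp i) = 0.
Proof.
move=> ij; rewrite one_sub_ramp /ramp !mulrBl !mulrBr.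
rewrite !ppart_mul_npart ?subr0//; lia.
Qed.

Lemma tent_orthogonal i j : (i.+1 < j)%N -> tent j * tent i = 0.
Proof.
move=> ij; have -> : tent j * tent i =
    ramp j * (1 - ramp i.+1) - ramp j * (1 - ramp i)
    - (ramp j.+1 * (1 - ramp i.+1) - ramp j.+1 * (1 - ramp i)).
  by rewrite /tent; ring.
rewrite !ramp_orthogonal ?subr0//; lia.
Qed.

Definition tent_comb (m s : nat) := \sum_(k < m) tent (3 * k + s).

(** The halved tents have norm at most 1 and pairwise zero products. *)
Lemma tent_comb_norm (m s : nat) : N (tent_comb m s) <= 2.
Proof.
have -> : tent_comb m s = cst 2 * \sum_(k < m) h * tent (3 * k + s).
  rewrite -mulr_sumr mulrA -rmorphM divff ?rmorph1 ?mul1r//.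
rewrite (fnormZ HN) ger0_norm// ler_piMr//.
apply: (@fnorm_orthogonal_sum (fun k => h * tent (3 * k + s))).
  move=> k; rewrite (fnormZ HN) ger0_norm ?invr_ge0//.
  by have := tent_norm (3 * k + s); lra.
move=> k l kl; rewrite mulrACA.
suff -> : tent (3 * k + s) * tent (3 * l + s) = 0 by rewrite mulr0.
have [lk|lk|/eqP] := ltngtP k l; last by rewrite (negbTE kl).
  by rewrite mulrC tent_orthogonal//; lia.
by rewrite tent_orthogonal//; lia.
Qed.

(** The sum telescopes to the positive part of a - 1 minus that of a - (3m + 1),
    and 2 <= a <= 3m makes the former equal to a - 1 and the latter to 0. The
    margins of 1 provide the strictly negative eigenvalue that
    [fpositive_eigen] excludes. *)
Lemma sum_ramp m : fpositive (a - 2) -> fpositive ((3 * m)%N%:R - a) ->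
  \sum_(k < 3 * m) ramp k.+1 = a - 1.
Proof.
move=> a2 am.
have -> n : \sum_(k < n) ramp k.+1 = ppart 1 - ppart n.+1.
  elim: n => [|n IH]; first by rewrite big_ord0 subrr.
  by rewrite big_ord_recr /= IH /ramp; ring.
have n1 : npart 1 = 0.
  apply: (fpositive_eigen (fpositiveD a2 (abs_pos 1)) ltr01).
  have e := mul_npart 1; rewrite mulrDl -npart_sq rmorph1 mul1r.
  transitivity ((a - 1%:R) * npart 1 - npart 1 + npart 1 ^+ 2); first by ring.
  by rewrite e; ring.
have pL : ppart (3 * m)%N.+1 = 0.
  apply: (fpositive_eigen (fpositiveD am (abs_pos (3 * m)%N.+1)) ltr01).
  set L := (3 * m)%N.+1.
  have e := mul_ppart L; rewrite mulrDl -ppart_sq rmorph1 mul1r.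
  transitivity (- ((a - L%:R) * ppart L) - ppart L + ppart L ^+ 2).
    by rewrite /L -[in RHS]natr1; ring.
  by rewrite e; ring.
by rewrite pL subr0 -(pnpart_sub 1) n1 subr0.
Qed.

End Tents.

(** * Bilinear maps vanishing on zero products *)
Section ZeroProductForm.
Context (V : normedZmodType R[i]) (phi : B -> B -> V) (K : R)
  (phiDl : forall c c' d, phi (c + c') d = phi c d + phi c' d)
  (phiDr : forall c d d', phi c (d + d') = phi c d + phi c d')
  (phi_bound : forall c d, rnorm (phi c d) <= K * N c * N d)
  (phi_zero : forall c d, c * d = 0 -> phi c d = 0).

(** The defect D is additive and kills 1, so it may be computed after an integral
    affine change of a. *)
Let D c := phi c 1 - phi 1 c.

Let DD c d : D (c + d) = D c + D d.
Proof. by rewrite /D phiDl phiDr opprD addrACA. Qed.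

Let D0 : D 0 = 0.
Proof. by apply: (addrI (D 0)); rewrite -DD !addr0. Qed.

Let DN c : D (- c) = - D c.
Proof. by apply: (addrI (D c)); rewrite -DD !subrr D0. Qed.

Let DMn c n : D (c *+ n) = D c *+ n.
Proof. by elim: n => [|n IH]; rewrite ?mulr0n ?D0// !mulrS DD IH. Qed.

Let Dsum n (f : nat -> B) : D (\sum_(k < n) f k) = \sum_(k < n) D (f k).
Proof. by elim: n => [|n IH]; rewrite ?big_ord0 ?D0// !big_ord_recr /= DD IH. Qed.

Let phi_suml n (f : nat -> B) d : phi (\sum_(k < n) f k) d = \sum_(k < n) phi (f k) d.
Proof.
elim: n => [|n IH]; first by rewrite !big_ord0 phi_zero// mul0r.
by rewrite !big_ord_recr /= phiDl IH.
Qed.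

Let phi_sumr n (f : nat -> B) c : phi c (\sum_(k < n) f k) = \sum_(k < n) phi c (f k).
Proof.
elim: n => [|n IH]; first by rewrite !big_ord0 phi_zero// mulr0.
by rewrite !big_ord_recr /= phiDr IH.
Qed.

Let K_ge0 : 0 <= K.
Proof.
have : 0 < N 1.
  rewrite lt_def (fnorm_ge0 HN) andbT; apply/eqP => /(fnorm_eq0 HN) /eqP.
  by rewrite oner_eq0.
move=> n0; have := phi_bound 1 1; have := rnorm_ge0 (phi 1 1).
by move=> /le_trans h /h; rewrite pmulr_lge0// pmulr_lge0.
Qed.

(** The bound depends on phi only, while m measures the length of the interval
    over which a is spread. *)
Lemma defect_bound a m : fpositive (a - 2) -> fpositive ((3 * m)%N%:R - a) ->
  rnorm (D a) <= 24 * K.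
Proof.
move=> a2 am.
have /choice[abs habs] : forall i, exists q, fpositive q /\ q ^+ 2 = (a - i%:R) ^+ 2.
  by move=> i; have [q] := exists_abs (a - i%:R); exists q.
have ap i := (habs i).1; have asq i := (habs i).2.
pose g := ramp a abs; pose e := tent a abs.
have gS i : g i.+1 = e i.+1 + g i.+2 by rewrite /e /tent subrK.
have gS' i : 1 - g i.+1 = e i + (1 - g i) by rewrite /e /tent -/g; ring.
have go i j : (i < j)%N -> g j * (1 - g i) = 0 by exact: ramp_orthogonal.
have eo i : e i.+1 * (1 - g i) = 0.
  by rewrite /e /tent -/g mulrBl !go// subr0.
(* phi(g, 1) and phi(1, g) share phi(g, g). In phi(g, 1 - g) the factor g may be
   replaced by e_(i+1), since g_(i+2)(1 - g_(i+1)) = 0, and then 1 - g_(i+1) by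
   e_i, since e_(i+1)(1 - g_i) = 0. *)
have Dg i : D (g i.+1) = phi (e i.+1) (e i) - phi (e i) (e i.+1).
  have -> : D (g i.+1) = phi (g i.+1) (1 - g i.+1) - phi (1 - g i.+1) (g i.+1).
    rewrite /D -[X in phi _ X - _](subrKC (g i.+1)) -[X in _ - phi X _](subrKC (g i.+1)).
    rewrite (phiDl (g i.+1) (1 - _)) (phiDr _ (g i.+1)).
    by rewrite [X in X - _]addrC addrKA.
  have -> : phi (g i.+1) (1 - g i.+1) = phi (e i.+1) (e i).
    have z1 : phi (g i.+2) (1 - g i.+1) = 0 by rewrite phi_zero// go.
    have z2 : phi (e i.+1) (1 - g i) = 0 by rewrite phi_zero// eo.
    transitivity (phi (e i.+1 + g i.+2) (1 - g i.+1)); first by rewrite -gS.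
    by rewrite (phiDl (e i.+1)) z1 addr0 gS' (phiDr _ (e i)) z2 addr0.
  have -> // : phi (1 - g i.+1) (g i.+1) = phi (e i) (e i.+1).
  have z1 : phi (1 - g i.+1) (g i.+2) = 0 by rewrite phi_zero// mulrC go.
  have z2 : phi (1 - g i) (e i.+1) = 0 by rewrite phi_zero// mulrC eo.
  transitivity (phi (1 - g i.+1) (e i.+1 + g i.+2)); first by rewrite -gS.
  by rewrite (phiDr _ (e i.+1)) z1 addr0 gS' (phiDl (e i)) z2 addr0.
have -> : D a = \sum_(k < 3 * m) (phi (e k.+1) (e k) - phi (e k) (e k.+1)).
  under eq_bigr do rewrite -Dg.
  rewrite -(Dsum _ (fun k => g k.+1)) sum_ramp// DD DN.
  by rewrite [D 1]subrr subr0.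
pose c := tent_comb a abs m.
have split3 (f : nat -> V) : \sum_(k < 3 * m) f k =
   \sum_(k < m) (f (3 * k + 0)%N + f (3 * k + 1)%N + f (3 * k + 2)%N).
  elim: m {am c} => [|n IH]; first by rewrite !big_ord0.
  rewrite [RHS]big_ord_recr /= -IH (_ : (3 * n.+1 = (3 * n).+3)%N); last by lia.
  by rewrite !big_ord_recr /= !addnS !addn0 !addrA.
(* For k != l the indices 3k + s and 3l + t differ by at least 2. *)
have diag (s t : nat) : (s <= t.+1)%N -> (t <= s.+1)%N ->
    phi (c s) (c t) = \sum_(k < m) phi (e (3 * k + s)%N) (e (3 * k + t)%N).
  move=> st ts; rewrite /c /tent_comb (phi_suml _ (fun k => tent a abs (3 * k + s))).
  apply: eq_bigr => k _; rewrite (phi_sumr _ (fun k => tent a abs (3 * k + t))).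
  rewrite (bigD1 k)//= big1 ?addr0// => l lk; apply: phi_zero.
  have [kl|kl|kl] := ltngtP k l.
  - by rewrite mulrC tent_orthogonal//; lia.
  - by rewrite tent_orthogonal//; lia.
  - by move/eqP: lk; case; apply/val_inj.
have dl (s : nat) : \sum_(k < m) phi (e (3 * k + s).+1%N) (e (3 * k + s)%N) = phi (c s.+1) (c s).
  rewrite diag; [|lia|lia].
  by apply: eq_bigr => k _; rewrite addnS.
have dr (s : nat) : \sum_(k < m) phi (e (3 * k + s)%N) (e (3 * k + s).+1%N) = phi (c s) (c s.+1).
  rewrite diag; [|lia|lia].
  by apply: eq_bigr => k _; rewrite addnS.
rewrite (split3 (fun k => phi (e k.+1) (e k) - phi (e k) (e k.+1))) !big_split /= !sumrN.
rewrite !dl !dr.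
have cb (s t : nat) : rnorm (phi (c s) (c t)) <= 4 * K.
  apply: le_trans (phi_bound _ _) _.
  have := tent_comb_norm ap asq m s; have := tent_comb_norm ap asq m t.
  have := fnorm_ge0 HN (c s); have := fnorm_ge0 HN (c t).
  rewrite -/(c s) -/(c t) => t0 s0 t2 s2.
  have : N (c s) * N (c t) <= 2 * 2 by rewrite ler_pM.
  by move=> /(ler_wpM2l K_ge0); rewrite mulrA; lra.
have cb2 (s : nat) : rnorm (phi (c s.+1) (c s) - phi (c s) (c s.+1)) <= 8 * K.
  by apply: le_trans (ler_rnormB _ _) _; have := cb s.+1 s; have := cb s s.+1; lra.
apply: le_trans (ler_rnormD _ _) _.
have := ler_rnormD (phi (c 1) (c 0) - phi (c 0) (c 1)) (phi (c 2) (c 1) - phi (c 1) (c 2)).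
have := cb2 0%N; have := cb2 1%N; have := cb2 2%N; lra.
Qed.

(** The defect of ma + const is m times that of a, yet bounded independently of
    m. *)
Lemma zero_product_balanced a : phi a 1 = phi 1 a.
Proof.
apply/subr0_eq; rewrite -/(D a); apply: rnorm_eq0_le.
pose s := Num.bound (N a).
have hs : N a <= s%:R by apply/ltW/archi_boundP/(fnorm_ge0 HN).
have key m : m%:R * rnorm (D a) <= 24 * K.
  (* With |a| <= s, the element b lies between 2 and 2ms + 2 <= 3(ms + 1). *)
  pose b := a *+ m + (m * s + 2)%N%:R.
  have NB : N (a *+ m) <= (m * s)%N%:R.
    have cn : cst m%:R = m%:R :> B by apply: rmorph_nat.
    rewrite -(mulr_natl a) -cn (fnormZ HN) ger0_norm// natrM.
    by rewrite ler_wpM2l.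
  have -> : m%:R * rnorm (D a) = rnorm (D b).
    rewrite DD -ler_rnormMn -DMn.
    have -> : D (m * s + 2)%N%:R = 0 by rewrite DMn [D 1]subrr mul0rn.
    by rewrite addr0.
  apply: (@defect_bound b (m * s + 1)%N).
    have -> : b - 2 = cst (m * s)%N%:R + a *+ m.
      rewrite rmorph_nat /b; ring.
    exact: fpositive_shift.
  have -> : (3 * (m * s + 1))%N%:R - b = cst (2 * (m * s) + 1)%N%:R + - (a *+ m).
    by rewrite rmorph_nat /b; ring.
  apply: fpositive_shift => //; rewrite fnormN (le_trans NB)// ler_nat; lia.
rewrite leNgt; apply/negP => d0.
have := key (Num.bound (24 * K / rnorm (D a))).
rewrite -ler_pdivlMr//; apply/negP; rewrite -ltNge.
by apply: archi_boundP; rewrite divr_ge0// ?mulr_ge0// ltW.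
Qed.

End ZeroProductForm.



(** * An approximate unit of the form g x^2 *)

(** Let t = 1 - e x^2, of norm at most 1, and let q be the mean of
    1, t, ..., t^(n-1). Then 1 - q is a multiple of x^2, while
    e x^2 q = (1 - t^n)/n, so |xq|^2 = |x^2 q^2| <= 2/(en). *)
Lemma fnorm_sq_approx_unit x (eps : R) : 0 < eps ->
  exists g, N (x * (1 - g * x ^+ 2)) <= eps.
Proof.
move=> eps0; pose k := 1 + N x; have k0 : 0 < k by rewrite ltr_pwDl// (fnorm_ge0 HN).
pose e := k^-1 ^+ 2; have e0 : 0 < e by rewrite /e exprn_gt0// invr_gt0.
pose t := 1 - cst e * x ^+ 2.
have t1 : N t <= 1.
  have -> : t = 1 - (cst k^-1 * x) ^+ 2 by rewrite exprMn -rmorphXn.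
  apply: fnorm_one_sub_sq; rewrite (fnormZ HN) ger0_norm ?invr_ge0 ?(ltW k0)//.
  by rewrite ler_pdivrMl// mulr1 lerDr.
pose S n := \sum_(i < n) t ^+ i.
have geo n : cst e * x ^+ 2 * S n = 1 - t ^+ n.
  have -> : cst e * x ^+ 2 = - (t - 1) by rewrite /t; ring.
  by rewrite mulNr -subrX1 opprB.
have NS n : N (S n) <= n%:R.
  elim: n => [|n IH]; first by rewrite /S big_ord0 fnorm0.
  rewrite /S big_ord_recr /= (le_trans (fnormD HN _ _))// -natr1 lerD//.
  exact: fnormX_le1.
pose m := (Num.bound (2 / (e * eps ^+ 2))).+1.
have m0 : 0 < m%:R :> R by rewrite ltr0n.
have mV : cst m%:R^-1 * m%:R = 1 :> B.
  have -> : m%:R = cst m%:R :> B by rewrite rmorph_nat.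
  by rewrite mulrC cstV.
pose g := cst (m%:R^-1 * e) * \sum_(j < m) S j.
have eg : 1 - g * x ^+ 2 = cst m%:R^-1 * S m.
  have h1 : g * x ^+ 2 = cst m%:R^-1 * \sum_(j < m) (1 - t ^+ j).
    under eq_bigr do rewrite -geo.
    by rewrite -mulr_sumr /g rmorphM; ring.
  by rewrite h1 sumrB sumr_const card_ord mulrBr mV opprB addrC subrK.
exists g; rewrite eg.
have eps2 : 2 <= m%:R * (e * eps ^+ 2).
  have : 2 / (e * eps ^+ 2) <= m%:R.
    apply/ltW; apply: lt_le_trans (archi_boundP _) _.
      by rewrite divr_ge0// mulr_ge0 ?(ltW e0) ?sqr_ge0.
    by rewrite ler_nat.
  by rewrite ler_pdivrMr; [|exact: mulr_gt0 e0 (exprn_gt0 2 eps0)].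
suff : N (x * (cst m%:R^-1 * S m)) ^+ 2 <= eps ^+ 2.
  by rewrite ler_pXn2r// nnegrE ?(fnorm_ge0 HN) ?(ltW eps0).
rewrite -fnormX2.
have -> : (x * (cst m%:R^-1 * S m)) ^+ 2 =
    cst (m%:R^-1 ^+ 2 * e^-1) * ((1 - t ^+ m) * S m).
  have ee := cstV e0; rewrite -geo (rmorphM cst) (rmorphXn cst).
  transitivity (cst m%:R^-1 ^+ 2 * (cst e * cst e^-1) * x ^+ 2 * S m ^+ 2); last by ring.
  by rewrite ee; ring.
have c0 : 0 < m%:R^-1 ^+ 2 * e^-1 :> R by rewrite mulr_gt0 ?exprn_gt0 ?invr_gt0.
rewrite (fnormZ HN) (ger0_norm (ltW c0)).
have NN : N ((1 - t ^+ m) * S m) <= 2 * m%:R.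
  apply: le_trans (fnormM HN _ _) _; rewrite ler_pM ?(fnorm_ge0 HN)//.
  have := fnormB 1 (t ^+ m); have := fnorm1 HN; have := fnormX_le1 m t1; lra.
apply: le_trans (ler_wpM2l (ltW c0) NN) _.
have -> : m%:R^-1 ^+ 2 * e^-1 * (2 * m%:R) = 2 / (m%:R * e) :> R.
  by field; rewrite !gt_eqF.
by rewrite ler_pdivrMr; [lra|exact: mulr_gt0].
Qed.

End FunctionNorm.

(** * The norm of a C*-algebra *)

Section CStarNorm.
Context (R : realType) (A : cstarAlgType R).
Implicit Types a b : A.

Lemma cmul0l a : cmul 0 a = 0.
Proof. by apply: (addrI (cmul 0 a)); rewrite -cmulDl !addr0. Qed.

Lemma cmul0r a : cmul a 0 = 0.
Proof. by apply: (addrI (cmul a 0)); rewrite -cmulDr !addr0. Qed.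

Lemma cstar0 : cstar 0 = 0 :> A.
Proof. by apply: (addrI (cstar 0)); rewrite -cstarD !addr0. Qed.

Lemma cstarN a : cstar (- a) = - cstar a.
Proof. by apply: (addrI (cstar a)); rewrite -cstarD !subrr cstar0. Qed.

Lemma rnorm_cmul a b : rnorm (cmul a b) <= rnorm a * rnorm b.
Proof. by rewrite -lecR rmorphM /= !rnormE cmul_normM. Qed.

Lemma rnorm_star_mul a : rnorm (cmul (cstar a) a) = rnorm a ^+ 2.
Proof. by apply: complexI; rewrite rmorphXn /= !rnormE cstar_norm. Qed.

Lemma rnorm_cstar a : rnorm (cstar a) = rnorm a.
Proof.
suff le b : rnorm b <= rnorm (cstar b).
  by apply/eqP; rewrite eq_le le andbT -{2}(cstarK a) le.
have := rnorm_cmul (cstar b) b; rewrite rnorm_star_mul expr2.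
have [/eqP b0|b0] := boolP (rnorm b == 0); first by rewrite b0 rnorm_ge0.
by rewrite ler_pM2r// lt_def b0 rnorm_ge0.
Qed.

Lemma rnorm_mul_star a : rnorm (cmul a (cstar a)) = rnorm a ^+ 2.
Proof. by rewrite -{1}(cstarK a) rnorm_star_mul rnorm_cstar. Qed.

End CStarNorm.

Section ComplexModulus.
Context (R : realType).
Implicit Types l m : R[i].

Lemma rnormM l m : rnorm (l * m) = rnorm l * rnorm m.
Proof. by apply: complexI; rewrite rmorphM /= !rnormE normrM. Qed.

Lemma rnorm_conj l : rnorm l^* = rnorm l.
Proof. by apply: complexI; rewrite !rnormE !normc_def; case: l => x y /=; rewrite sqrrN. Qed.

Lemma rnorm_real (r : R) : rnorm r%:C = `|r|.
Proof. by rewrite /rnorm normc_def /= expr0n /= addr0 sqrtr_sqr. Qed.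

Lemma rnorm1 : rnorm (1 : R[i]) = 1.
Proof. by rewrite -[1 in LHS]/((1 : R)%:C) rnorm_real normr1. Qed.

Lemma rnormZ (V : normedModType R[i]) l (v : V) : rnorm (l *: v) = rnorm l * rnorm v.
Proof. by apply: complexI; rewrite rmorphM /= !rnormE normrZ. Qed.

End ComplexModulus.

(** * The unitization *)

(** A copy of the product A * R[i], without its componentwise multiplication. *)
Definition unitz (R : realType) (A : cstarAlgType R) : Type := (A * R[i])%type.

HB.instance Definition _ (R : realType) (A : cstarAlgType R) :=
  GRing.Zmodule.copy (unitz A) (A * R[i])%type.

Section Unitization.
Context (R : realType) (A : cstarAlgType R).
Implicit Types (u v w : unitz A) (z a b : A) (l : R[i]) (M r : R).

Definition unitz_mul u v : unitz A := unitization_mul u v.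

Lemma unitz_eq u v : u.1 = v.1 -> u.2 = v.2 -> u = v.
Proof. by case: u v => [? ?] [? ?] /= -> ->. Qed.

Lemma unitz_mulA : associative unitz_mul.
Proof.
move=> u v w; apply: unitz_eq => /=; last by rewrite mulrA.
rewrite !cmulDl !cmulDr !scalerDr !cmulZl !cmulZr !scalerA cmulA -!addrA.
congr (_ + _); rewrite ![w.2 * _]mulrC addrCA; congr (_ + _).
by rewrite [X in _ + X]addrCA addrCA.
Qed.

Lemma unitz_mul1l : left_id (0, 1) unitz_mul.
Proof. by move=> u; apply: unitz_eq; rewrite /= ?mul1r// cmul0l scaler0 !add0r scale1r. Qed.

Lemma unitz_mul1r : right_id (0, 1) unitz_mul.
Proof. by move=> u; apply: unitz_eq; rewrite /= ?mulr1// cmul0r scaler0 addr0 add0r scale1r. Qed.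

Lemma unitz_mulDl : left_distributive unitz_mul +%R.
Proof.
move=> u v w; apply: unitz_eq => /=; last by rewrite mulrDl.
by rewrite cmulDl scalerDr scalerDl (addrACA (cmul u.1 _)) [LHS]addrACA.
Qed.

Lemma unitz_mulDr : right_distributive unitz_mul +%R.
Proof.
move=> u v w; apply: unitz_eq => /=; last by rewrite mulrDr.
by rewrite cmulDr scalerDr scalerDl [X in X + _ = _]addrACA [LHS]addrACA.
Qed.

Lemma unitz_1neq0 : ((0, 1) : unitz A) != 0.
Proof. by apply/eqP => -[/eqP]; rewrite oner_eq0. Qed.

HB.instance Definition _ := GRing.Zmodule_isNzRing.Build (unitz A)
  unitz_mulA unitz_mul1l unitz_mul1r unitz_mulDl unitz_mulDr unitz_1neq0.

Definition unitz_scalar l : unitz A := (0, l).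

Lemma unitz_scalarD l m : unitz_scalar (l + m) = unitz_scalar l + unitz_scalar m.
Proof. by apply: unitz_eq => //=; rewrite addr0. Qed.

Lemma unitz_scalarM l m : unitz_scalar (l * m) = unitz_scalar l * unitz_scalar m.
Proof. by apply: unitz_eq => //=; rewrite cmul0l !scaler0 !addr0. Qed.

Lemma unitz_scalar_mul l u : unitz_scalar l * u = (l *: u.1, l * u.2).
Proof. by apply: unitz_eq => //=; rewrite cmul0l scaler0 !add0r. Qed.

Lemma unitz_scalar_comm l u : unitz_scalar l * u = u * unitz_scalar l.
Proof.
rewrite unitz_scalar_mul; apply: unitz_eq => /=; last by rewrite mulrC.
by rewrite cmul0r scaler0 addr0 add0r.
Qed.

Definition unitz_star u : unitz A := (cstar u.1, u.2^*).

Lemma unitz_starK : involutive unitz_star.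
Proof. by move=> u; apply: unitz_eq; rewrite /= ?cstarK ?conjcK. Qed.

Lemma unitz_starD u v : unitz_star (u + v) = unitz_star u + unitz_star v.
Proof. by apply: unitz_eq; rewrite /= ?cstarD ?rmorphD. Qed.

Lemma unitz_starN u : unitz_star (- u) = - unitz_star u.
Proof. by apply: unitz_eq; rewrite /= ?cstarN ?rmorphN. Qed.

Lemma unitz_starM u v : unitz_star (u * v) = unitz_star v * unitz_star u.
Proof.
apply: unitz_eq => /=; last by rewrite rmorphM mulrC.
by rewrite !cstarD cstarM !cstarZ -!addrA; congr (_ + _); rewrite addrC.
Qed.

Lemma unitz_star_scalar l : unitz_star (unitz_scalar l) = unitz_scalar l^*.
Proof. by apply: unitz_eq => //=; rewrite cstar0. Qed.

(** The right action of A~ on A. *)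
Definition cact z u : A := cmul z u.1 + u.2 *: z.

Lemma cactM z u v : cact z (u * v) = cact (cact z u) v.
Proof.
rewrite /cact /= !cmulDl !cmulDr !scalerDr !cmulZr cmulZl cmulA scalerA.
by rewrite -!addrA (mulrC u.2); congr (_ + _); rewrite addrCA.
Qed.

Lemma cactD z u v : cact z (u + v) = cact z u + cact z v.
Proof. by rewrite /cact /= cmulDr scalerDl addrACA. Qed.

Lemma cmul_cact z a u : cmul z (cact a u) = cact (cmul z a) u.
Proof. by rewrite /cact cmulDr cmulA cmulZr. Qed.

Lemma cmul_cstar_cact z a u :
  cmul z (cstar (cact a u)) = cmul (cact z (unitz_star u)) (cstar a).
Proof. by rewrite /cact cstarD cstarM cstarZ cmulDl cmulDr cmulA cmulZr cmulZl. Qed.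

Lemma cact_scalar l z : cact z (unitz_scalar l) = l *: z.
Proof. by rewrite /cact /= cmul0r add0r. Qed.

(** The norm of u as a right multiplier of A is only a seminorm when A has a unit
    of its own, which then acts like 1. The character u |-> u.2 separates the
    two; the maximum of both quantities is a C*-norm in every case. *)
Definition unitz_bound u M :=
  rnorm u.2 <= M /\ forall z, rnorm (cact z u) <= M * rnorm z.

Lemma unitz_bound_ge0 u M : unitz_bound u M -> 0 <= M.
Proof. by move=> [h _]; apply: le_trans (rnorm_ge0 _) h. Qed.

Lemma unitz_bound_exists u : unitz_bound u (rnorm u.1 + rnorm u.2).
Proof.
split; first by rewrite lerDr rnorm_ge0.
move=> z; rewrite mulrDl (le_trans (ler_rnormD _ _))// rnormZ lerD2r mulrC.
exact: rnorm_cmul.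
Qed.

Definition unitz_norm u : R := inf [set M | unitz_bound u M].

Lemma unitz_norm_le u M : unitz_bound u M -> unitz_norm u <= M.
Proof.
move=> h; apply: ge_inf => //; exists 0 => N; exact: unitz_bound_ge0.
Qed.

Lemma unitz_normP u : unitz_bound u (unitz_norm u).
Proof.
have ne : [set M | unitz_bound u M] !=set0.
  by exists (rnorm u.1 + rnorm u.2); exact: unitz_bound_exists.
split; first by apply: lb_le_inf => // M [].
move=> z; have [z0|z0] := leP (rnorm z) 0.
  by rewrite (rnorm_eq0_le z0) /cact cmul0l scaler0 addr0 !rnorm0 mulr0.
rewrite -ler_pdivrMr//; apply: lb_le_inf => // M [_ h].
by rewrite ler_pdivrMr.
Qed.

Lemma unitz_norm_ge0 u : 0 <= unitz_norm u.
Proof. exact: unitz_bound_ge0 (unitz_normP u). Qed.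

Lemma rnorm_cact z u : rnorm (cact z u) <= unitz_norm u * rnorm z.
Proof. by case: (unitz_normP u). Qed.

Lemma unitz_normD u v : unitz_norm (u + v) <= unitz_norm u + unitz_norm v.
Proof.
have [hu hu'] := unitz_normP u; have [hv hv'] := unitz_normP v.
apply: unitz_norm_le; split => [|z].
  by rewrite (le_trans (ler_rnormD _ _))// lerD.
by rewrite cactD mulrDl (le_trans (ler_rnormD _ _))// lerD.
Qed.

Lemma unitz_normM u v : unitz_norm (u * v) <= unitz_norm u * unitz_norm v.
Proof.
have [hu hu'] := unitz_normP u; have [hv hv'] := unitz_normP v.
apply: unitz_norm_le; split => [|z].
  by rewrite rnormM ler_pM// rnorm_ge0.
rewrite cactM (le_trans (hv' _))// -mulrA mulrCA.
by apply: ler_wpM2l; [exact: unitz_norm_ge0|exact: hu'].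
Qed.

Lemma unitz_norm_scalarM l u : unitz_norm (unitz_scalar l * u) = rnorm l * unitz_norm u.
Proof.
have le m v : unitz_norm (unitz_scalar m * v) <= rnorm m * unitz_norm v.
  have [hv hv'] := unitz_normP v; apply: unitz_norm_le; split => [|z].
    by rewrite unitz_scalar_mul rnormM ler_wpM2l// rnorm_ge0.
  by rewrite unitz_scalar_comm cactM cact_scalar rnormZ -mulrA ler_wpM2l ?rnorm_ge0.
apply/eqP; rewrite eq_le le /=.
have [->|l0] := eqVneq l 0; first by rewrite rnorm0 mul0r unitz_norm_ge0.
have := le l^-1 (unitz_scalar l * u).
rewrite mulrA -unitz_scalarM mulVf// mul1r.
have lp : 0 < rnorm l.
  by rewrite ltNge; apply/negP => /rnorm_eq0_le /eqP; rewrite (negbTE l0).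
move=> h; rewrite -ler_pdivlMl//; apply: le_trans h _.
suff -> : rnorm l^-1 = (rnorm l)^-1 by [].
have lp0 : rnorm l != 0 by rewrite gt_eqF.
by apply: (mulfI lp0); rewrite -rnormM !divff// rnorm1.
Qed.

Lemma unitz_norm1 : unitz_norm 1 <= 1.
Proof.
apply: unitz_norm_le; split; first by rewrite /= rnorm1.
by move=> z; rewrite cact_scalar scale1r mul1r.
Qed.

Lemma unitz_norm_star u : unitz_norm (unitz_star u) <= unitz_norm u.
Proof.
have [hu hu'] := unitz_normP u.
apply: unitz_norm_le; split => [|z]; first by rewrite rnorm_conj.
set w := cact z _.
have [w0|w0] := leP (rnorm w) 0.
  by apply: le_trans w0 _; rewrite mulr_ge0 ?unitz_norm_ge0 ?rnorm_ge0.
rewrite -(ler_pM2l w0) -expr2 -rnorm_mul_star cmul_cstar_cact unitz_starK.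
apply: le_trans (rnorm_cmul _ _) _; rewrite rnorm_cstar mulrA ler_wpM2r ?rnorm_ge0//.
by rewrite mulrC hu'.
Qed.

(** The nontrivial half of the C*-identity: |zu|^2 is the norm of zu times its
    adjoint, and this product is z(u u^* ) times the adjoint of z. *)
Lemma unitz_norm_mul_star u : unitz_norm u ^+ 2 <= unitz_norm (u * unitz_star u).
Proof.
have [h h'] := unitz_normP (u * unitz_star u).
set M := unitz_norm (_ * _) in h h' *.
have M0 : 0 <= M by exact: unitz_norm_ge0.
suff : unitz_bound u (Num.sqrt M).
  move=> /unitz_norm_le; rewrite -(@ler_pXn2r _ 2)// ?nnegrE ?sqrtr_ge0 ?unitz_norm_ge0//.
  by rewrite sqr_sqrtr.
split=> [|z].
  rewrite -(@ler_pXn2r _ 2)// ?nnegrE ?sqrtr_ge0 ?rnorm_ge0// sqr_sqrtr//.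
  by apply: le_trans h; rewrite rnormM rnorm_conj expr2.
rewrite -(@ler_pXn2r _ 2)// ?nnegrE ?mulr_ge0 ?sqrtr_ge0 ?rnorm_ge0// exprMn sqr_sqrtr//.
rewrite -rnorm_mul_star cmul_cstar_cact -cactM (le_trans (rnorm_cmul _ _))//.
by rewrite rnorm_cstar expr2 mulrA ler_wpM2r ?rnorm_ge0.
Qed.

Lemma rnorm_le_unitz_norm a : rnorm a <= unitz_norm (a, 0).
Proof.
have [_ /(_ (cstar a))] := unitz_normP (a, 0).
rewrite /cact /= scale0r addr0 rnorm_star_mul rnorm_cstar expr2.
have [a0 _|a0] := leP (rnorm a) 0; last by rewrite ler_pM2r.
by apply: le_trans a0 (unitz_norm_ge0 _).
Qed.

Lemma unitz_norm_eq0 u : unitz_norm u <= 0 -> u = 0.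
Proof.
move=> h; have [hu hu'] := unitz_normP u.
have u2 : u.2 = 0 by apply: rnorm_eq0_le; apply: le_trans hu h.
apply: unitz_eq => //; apply: rnorm_eq0_le.
by apply: le_trans (rnorm_le_unitz_norm _) _; rewrite -u2 -surjective_pairing.
Qed.

End Unitization.

(** * The self-adjoint part of a bicommutant *)
Section SelfAdjointBicommutant.
Context (R : realType) (A : cstarAlgType R).
Implicit Types (u v w : unitz A).

(** The bicommutant of a is commutative and closed under limits by its mere
    definition, so no completion of the polynomials in a has to be taken. *)
Definition in_bicommutant (a u : unitz A) :=
  forall v, v * a = a * v -> v * u = u * v.

Definition sa_bicommutant (a : unitz A) : {pred unitz A} :=
  fun u => `[< unitz_star u = u /\ in_bicommutant a u >].

Lemma sa_bicommutantP a u :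
  reflect (unitz_star u = u /\ in_bicommutant a u) (u \in sa_bicommutant a).
Proof. exact: asboolP. Qed.

Lemma mem_own_sa_bicommutant (h : A) : cstar h = h -> (h, 0) \in sa_bicommutant (h, 0).
Proof.
move=> hs; apply/sa_bicommutantP; split=> [|v //].
by apply: unitz_eq; [|exact: conjc0].
Qed.

(** An element of the bicommutant of a commutes with a, as a commutes with
    itself. *)
Lemma bicommutant_comm a u v : in_bicommutant a u -> in_bicommutant a v -> u * v = v * u.
Proof. by move=> hu hv; apply: hv; rewrite hu. Qed.

Lemma unitz_star1 : unitz_star (1 : unitz A) = 1.
Proof. by rewrite (unitz_star_scalar A 1) conjc1. Qed.

Lemma sa_bicommutant_subring a : subring_closed (sa_bicommutant a).
Proof.
split=> [|u v /sa_bicommutantP[su cu] /sa_bicommutantP[sv cv]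
         |u v /sa_bicommutantP[su cu] /sa_bicommutantP[sv cv]]; apply/sa_bicommutantP.
- by split=> [|v _]; rewrite ?unitz_star1// mulr1 mul1r.
- split=> [|w wa]; first by rewrite unitz_starD unitz_starN su sv.
  by rewrite mulrBr mulrBl cu// cv.
- split=> [|w wa]; first by rewrite unitz_starM su sv; exact: bicommutant_comm cv cu.
  by rewrite mulrA cu// -mulrA cv// mulrA.
Qed.

HB.instance Definition _ a :=
  GRing.isSubringClosed.Build (unitz A) (sa_bicommutant a) (sa_bicommutant_subring a).

Record sa_alg (a : unitz A) := SaAlg {sa_val :> unitz A; _ : sa_val \in sa_bicommutant a}.

HB.instance Definition _ a := [isSub for @sa_val a].
HB.instance Definition _ a := [Choice of sa_alg a by <:].
HB.instance Definition _ a := [SubChoice_isSubNzRing of sa_alg a by <:].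

Lemma sa_algP a (x : sa_alg a) : unitz_star (val x) = val x /\ in_bicommutant a (val x).
Proof. exact/sa_bicommutantP/(valP x). Qed.

Lemma sa_alg_mulC a : commutative (@GRing.mul (sa_alg a)).
Proof.
move=> x y; apply: val_inj.
exact: bicommutant_comm (sa_algP x).2 (sa_algP y).2.
Qed.

HB.instance Definition _ a := GRing.PzRing_hasCommutativeMul.Build (sa_alg a) (@sa_alg_mulC a).

Lemma scalar_in_bicommutant a (r : R) : unitz_scalar A r%:C \in sa_bicommutant a.
Proof.
apply/sa_bicommutantP; split; first by rewrite unitz_star_scalar conjc_real.
by move=> v _; rewrite unitz_scalar_comm.
Qed.

Definition sa_cst a (r : R) : sa_alg a := SaAlg (scalar_in_bicommutant a r).

Lemma sa_cst_is_zmod_morphism a : zmod_morphism (@sa_cst a).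
Proof.
move=> r s; apply: val_inj => /=.
rewrite !rmorphB /= unitz_scalarD; congr (_ + _).
by apply: unitz_eq => //=; rewrite oppr0.
Qed.

Lemma sa_cst_is_monoid_morphism a : monoid_morphism (@sa_cst a).
Proof.
split; first by apply: val_inj; rewrite /= rmorph1.
by move=> r s; apply: val_inj; rewrite /= !rmorphM /= unitz_scalarM.
Qed.

HB.instance Definition _ a := GRing.isZmodMorphism.Build R (sa_alg a) (@sa_cst a)
  (@sa_cst_is_zmod_morphism a).
HB.instance Definition _ a := GRing.isMonoidMorphism.Build R (sa_alg a) (@sa_cst a)
  (@sa_cst_is_monoid_morphism a).

Definition sa_norm a (x : sa_alg a) : R := unitz_norm (val x).


Lemma unitz_normN u : unitz_norm (- u) = unitz_norm u.
Proof.
have -> : - u = unitz_scalar A (- 1) * u.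
  by rewrite unitz_scalar_mul; apply: unitz_eq; rewrite /= ?scaleN1r ?mulN1r.
by rewrite unitz_norm_scalarM rnormN rnorm1 mul1r.
Qed.

Lemma unitz_norm_le_parts u : unitz_norm u <= rnorm u.1 + rnorm u.2.
Proof. exact: unitz_norm_le (unitz_bound_exists u). Qed.

Lemma rnorm_snd_le u : rnorm u.2 <= unitz_norm u.
Proof. by case: (unitz_normP u). Qed.

Lemma rnorm_fst_le u : rnorm u.1 <= 2 * unitz_norm u.
Proof.
apply: le_trans (rnorm_le_unitz_norm _) _.
have -> : (u.1, 0) = u + - (unitz_scalar A u.2).
  by apply: unitz_eq; rewrite /= ?oppr0 ?addr0 ?subrr.
apply: le_trans (unitz_normD _ _) _; rewrite unitz_normN.
have := unitz_norm_le_parts (unitz_scalar A u.2); rewrite /= rnorm0 add0r.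
have := rnorm_snd_le u; lra.
Qed.

(** This is the C*-identity for u = x + iy: u u^* = x^2 + y^2, and x is the mean
    of u and its adjoint. *)
Lemma sa_norm_sq a (x y : sa_alg a) : sa_norm x ^+ 2 <= sa_norm (x ^+ 2 + y ^+ 2).
Proof.
have [sx cx] := sa_algP x; have [sy cy] := sa_algP y.
pose i := unitz_scalar A 'i%C.
have ii : i * i = -1.
  rewrite /i -unitz_scalarM -expr2 sqr_i.
  by apply: unitz_eq; rewrite /= ?oppr0.
have ci v : i * v = v * i by exact: unitz_scalar_comm.
have si : unitz_star i = - i.
  rewrite unitz_star_scalar; apply: unitz_eq; rewrite /= ?oppr0//.
  by apply/eqP; rewrite eq_complex /= oppr0 !eqxx.
pose u := val x + i * val y.
have su : unitz_star u = val x - i * val y.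
  by rewrite unitz_starD unitz_starM sx sy si mulrN -ci.
have uu : u * unitz_star u = val (x ^+ 2 + y ^+ 2).
  rewrite su rmorphD !rmorphXn /= !expr2 /u mulrBr !mulrDl.
  have -> : i * val y * (i * val y) = - (val y * val y).
    by rewrite mulrA -[i * val y * i]mulrA -ci [i * (i * _)]mulrA ii -mulrA mulN1r.
  have -> : val x * (i * val y) = i * val y * val x.
    by rewrite mulrA -ci -!mulrA (bicommutant_comm cx cy).
  by rewrite addrKA opprK.
have xu : val x + val x = u + unitz_star u.
  by rewrite su /u addrACA subrr addr0.
have Nx : sa_norm x <= unitz_norm u.
  have : unitz_norm (val x + val x) <= unitz_norm u + unitz_norm u.
    rewrite xu (le_trans (unitz_normD _ _))// lerD2l; exact: unitz_norm_star.
  have -> : val x + val x = unitz_scalar A (2 : R)%:C * val x.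
    rewrite rmorph_nat unitz_scalar_mul; apply: unitz_eq => /=.
      by rewrite scaler_nat mulr2n.
    by rewrite mulr_natl mulr2n.
  rewrite unitz_norm_scalarM rnorm_real ger0_norm// /sa_norm; lra.
rewrite /sa_norm -uu; apply: le_trans (unitz_norm_mul_star u).
by rewrite ler_pXn2r// nnegrE ?unitz_norm_ge0.
Qed.

(** The two components converge separately: the scalar ones are real because the
    elements are self-adjoint. *)
Lemma sa_norm_complete a (p : nat -> sa_alg a) (P : nat -> R) (L : R) :
  (forall k, sa_norm (p k.+1 - p k) <= P k.+1 - P k) -> P @ \oo --> L ->
  exists l, forall k, sa_norm (l - p k) <= L - P k.
Proof.
move=> pP PL; pose q k := val (p k).
have qP j k : (j <= k)%N -> unitz_norm (q k - q j) <= P k - P j.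
  move=> /subnK <-; elim: (k - j)%N => [|n IH].
    by rewrite add0n !subrr (le_trans (unitz_norm_le_parts _))// !rnorm0 addr0.
  rewrite addSn.
  have -> : q (n + j).+1 - q j = (q (n + j).+1 - q (n + j)%N) + (q (n + j)%N - q j).
    by rewrite addrA subrK.
  apply: le_trans (unitz_normD _ _) _; have := pP (n + j)%N.
  rewrite /sa_norm rmorphB /= -/(q _) -/(q (n + j)%N); lra.
have ndP : {homo P : n m / (n <= m)%N >-> n <= m}.
  move=> n m nm; rewrite -subr_ge0; apply: le_trans (qP _ _ nm).
  exact: unitz_norm_ge0.
have PleL j : P j <= L.
  by have := nondecreasing_cvgn_le ndP (cvgP _ PL) j; rewrite (cvg_lim _ PL)//.
have [b hb] : exists b : A, forall j, rnorm (b - (q j).1) <= 2 * (L - P j).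
  apply: dominated_cvg_vector => // j k jk.
  apply: le_trans (rnorm_fst_le (q k - q j)) _.
  by rewrite ler_pM2l// qP.
have [r hr] : exists r : R, forall j, `|r - complex.Re (q j).2| <= L - P j.
  apply: dominated_cvg_real => // j k jk.
  apply: le_trans (qP _ _ jk); apply: le_trans (rnorm_snd_le _).
  rewrite -lecR rnormE -raddfB; exact: normc_ge_Re.
have q2 j : (q j).2 = (complex.Re (q j).2)%:C.
  have [/(congr1 snd) /= h _] := sa_algP (p j).
  have {}h : (q j).2^* = (q j).2 by exact: h.
  rewrite {1}[(q j).2]complexE.
  suff -> : complex.Im (q j).2 = 0 by rewrite rmorph0 mulr0 addr0.
  move: h; case: (q j).2 => s t /= [/eqP]; rewrite eq_sym -addr_eq0 -mulr2n.
  by rewrite mulrn_eq0 /= => /eqP.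
pose l : unitz A := (b, r%:C).
have lq j : unitz_norm (l - q j) <= 3 * (L - P j).
  apply: le_trans (unitz_norm_le_parts _) _.
  have -> : (l - q j).2 = (r - complex.Re (q j).2)%:C by rewrite rmorphB /= -q2.
  rewrite rnorm_real; have := hb j; have := hr j.
  have -> : (l - q j).1 = b - (q j).1 by [].
  lra.
have zero (x : unitz A) (C : R) : (forall j, unitz_norm x <= C * (L - P j)) -> x = 0.
  move=> h; apply: unitz_norm_eq0; apply: (@le0_of_tail R P L PL C _ 0%N).
  by move=> j _; exact: h.
have lsa : l \in sa_bicommutant a.
  apply/sa_bicommutantP; split => [|v va]; apply/subr0_eq.
    apply: (zero _ 6) => j; have [sj _] := sa_algP (p j).
    have -> : unitz_star l - l = unitz_star (l - q j) + - (l - q j).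
      by rewrite unitz_starD unitz_starN sj opprB addrA subrK.
    apply: le_trans (unitz_normD _ _) _; rewrite unitz_normN.
    by have := unitz_norm_star (l - q j); have := lq j; lra.
  apply: (zero _ (6 * unitz_norm v)) => j; have [_ cj] := sa_algP (p j).
  have -> : v * l - l * v = v * (l - q j) + - ((l - q j) * v).
    by rewrite mulrBr mulrBl cj// opprB addrA subrK.
  apply: le_trans (unitz_normD _ _) _; rewrite unitz_normN.
  have := unitz_normM v (l - q j); have := unitz_normM (l - q j) v.
  have : unitz_norm v * unitz_norm (l - q j) <= unitz_norm v * (3 * (L - P j)).
    by rewrite ler_wpM2l// unitz_norm_ge0.
  lra.
exists (SaAlg lsa) => k; rewrite -subr_le0.
apply: (@le0_of_tail R P L PL 2 _ k) => j kj; rewrite lerBlDr.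
have -> : sa_norm (SaAlg lsa - p k) = unitz_norm ((l - q j) + (q j - q k)).
  by rewrite addrA subrK.
apply: le_trans (unitz_normD _ _) _.
have := lq j; have := qP _ _ kj; lra.
Qed.

Lemma sa_norm_is_function_norm a : is_function_norm (@sa_cst a) (@sa_norm a).
Proof.
split.
- by move=> x; exact: unitz_norm_ge0.
- by move=> x y; exact: unitz_normD.
- by move=> r x; rewrite /sa_norm -rnorm_real; exact: unitz_norm_scalarM.
- by move=> x y; exact: unitz_normM.
- exact: unitz_norm1.
- exact: sa_norm_sq.
- by move=> x x0; apply/val_inj/unitz_norm_eq0; rewrite -/(sa_norm x) x0.
- exact: sa_norm_complete.
Qed.

End SelfAdjointBicommutant.

(** * Bounded operators and closed subspaces *)
Section OperatorNorm.
Context (R : realType) (X : completeNormedModType R[i]).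
Implicit Types (S T : {linear X -> X}) (M : set X) (x y : X).

Lemma bounded_operatorP S :
  bounded_operator S -> exists2 K : R, 0 <= K & forall x, rnorm (S x) <= K * rnorm x.
Proof.
move=> [M hM]; exists (rnorm M) => [|x]; first exact: rnorm_ge0.
rewrite -lecR rmorphM /= !rnormE; apply: le_trans (hM x) _.
have Mx : 0 <= M * `|x| by apply: le_trans (hM x).
by rewrite -(ger0_norm Mx) normrM normr_id.
Qed.

Lemma bounded_operator_of_rnorm S (K : R) :
  (forall x, rnorm (S x) <= K * rnorm x) -> bounded_operator S.
Proof. by move=> h; exists K%:C => x; rewrite -!rnormE -rmorphM lecR. Qed.

Lemma closed_approx M x : closed M ->
  (forall e : R, 0 < e -> exists2 y, M y & rnorm (x - y) < e) -> M x.
Proof.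
move=> cM h; apply: cM => B /nbhs_ballP[[e f] /=].
rewrite ltcE /= => /andP[/eqP -> e0] hB.
have [y My xy] := h _ e0; exists y; split => //; apply: hB.
by rewrite -ball_normE /= -rnormE ltcR.
Qed.

End OperatorNorm.

(** * Hilbert modules *)
Section HilbertModule.
Context (R : realType) (A : cstarAlgType R) (E : hilbertCStarModType A).
Implicit Types (x y z : E) (a b : A) (u v : unitz A) (S T : {linear E -> E}).

Lemma ract0l a : ract 0 a = 0 :> E.
Proof. by apply: (addrI (ract 0 a)); rewrite -ractDl !addr0. Qed.

Lemma ract0r x : ract x 0 = 0 :> E.
Proof. by apply: (addrI (ract x 0)); rewrite -ractDr !addr0. Qed.

Lemma inner0l y : inner (0 : E) y = 0.
Proof. by apply: (addrI (inner (0 : E) y)); rewrite -innerDl !addr0. Qed.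

Lemma innerNl x y : inner (- x) y = - inner x y.
Proof. by apply: (addrI (inner x y)); rewrite -innerDl !subrr inner0l. Qed.

Lemma inner_nondegenerate x y : (forall z, inner x z = inner y z) -> x = y.
Proof.
move=> h; apply/subr0_eq/inner_eq0.
by rewrite innerDl innerNl h subrr.
Qed.

Lemma inner_ractl x y a : inner (ract x a) y = cmul (cstar a) (inner x y).
Proof. by rewrite -inner_star inner_ract cstarM inner_star. Qed.

(** The right action of A~ on E. *)
Definition eact x u : E := ract x u.1 + u.2 *: x.

Lemma eactM x u v : eact x (u * v) = eact (eact x u) v.
Proof.
rewrite /eact /= !ractDr !ractDl !scalerDr !ractZr !ractZl ractM scalerA.
by rewrite -!addrA (mulrC u.2); congr (_ + _); rewrite addrCA.
Qed.

Lemma eactDr x u v : eact x (u + v) = eact x u + eact x v.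
Proof. by rewrite /eact /= ractDr scalerDl addrACA. Qed.

Lemma eactDl x y u : eact (x + y) u = eact x u + eact y u.
Proof. by rewrite /eact /= ractDl scalerDr addrACA. Qed.

Lemma eactZl (l : R[i]) x u : eact (l *: x) u = l *: eact x u.
Proof. by rewrite /eact /= ractZl scalerDr !scalerA mulrC. Qed.

Lemma eactN x u : eact x (- u) = - eact x u.
Proof.
apply: (addrI (eact x u)); rewrite -eactDr !subrr /eact /=.
by rewrite ract0r scale0r addr0.
Qed.

Lemma eact0 x : eact x 0 = 0.
Proof. by rewrite /eact /= ract0r scale0r addr0. Qed.

Lemma eact1 x : eact x 1 = x.
Proof. by rewrite /eact /= ract0r scale1r add0r. Qed.

Lemma eact_alg x a : eact x (a, 0) = ract x a.
Proof. by rewrite /eact /= scale0r addr0. Qed.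

Lemma inner_eact y x u : inner y (eact x u) = cact (inner y x) u.
Proof. by rewrite innerDr inner_ract innerZr. Qed.

Lemma exists_inner_sqrt x :
  exists h : A, [/\ cstar h = h, cmul h h = inner x x & rnorm x = rnorm h].
Proof.
have [h [[hs _] hh] xh] := inner_norm x.
by exists h; split => //; rewrite /rnorm xh.
Qed.

Lemma rnorm_inner x : rnorm (inner x x) = rnorm x ^+ 2.
Proof.
by have [h [hs <- ->]] := exists_inner_sqrt x; rewrite -{1}hs rnorm_star_mul.
Qed.

(** <xu, xu> = u^* h h u is the square of the norm of hu by the C*-identity; so
    norms in E can be computed in A. *)
Lemma rnorm_eact_sqrt x u h : cstar h = h -> cmul h h = inner x x ->
  rnorm (eact x u) = rnorm (cact h u).
Proof.
move=> hs hh; apply/eqP; rewrite -(@eqrXn2 _ 2)// ?rnorm_ge0//; apply/eqP.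
rewrite -rnorm_inner -rnorm_star_mul inner_eact cmul_cact; congr (rnorm (cact _ u)).
rewrite -inner_star inner_eact -hh -{1}hs -[RHS]cstarK cstarM cstarK.
by rewrite hs cmul_cact.
Qed.

Lemma rnorm_eact x u : rnorm (eact x u) <= unitz_norm u * rnorm x.
Proof.
have [h [hs hh ->]] := exists_inner_sqrt x.
by rewrite (rnorm_eact_sqrt u hs hh) rnorm_cact.
Qed.

(** * Operators leaving lat L(E) invariant are module maps *)
Lemma adjointable_ract T : adjointable T -> forall x a, T (ract x a) = ract (T x) a.
Proof.
move=> aT x a; apply: inner_nondegenerate => z; have [z' hz] := aT z.
by rewrite hz !inner_ractl hz.
Qed.

Lemma EndA_eact T : (forall x a, T (ract x a) = ract (T x) a) ->
  forall x u, T (eact x u) = eact (T x) u.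
Proof. by move=> h x u; rewrite /eact linearD linearZ h. Qed.

Lemma annihilator_lat d : lat (adjointable_operators E) [set z | eact z d = 0].
Proof.
split; last first.
  by move=> T aT z /= zd; rewrite -(EndA_eact (adjointable_ract aT)) zd linear0.
split.
- move=> z hz /=; apply: rnorm_eq0_le; apply/ler_addgt0Pr => e e0; rewrite add0r.
  have K0 : 0 < 1 + unitz_norm d by rewrite ltr_pwDl// unitz_norm_ge0.
  have e'0 : 0 < e / (1 + unitz_norm d) by rewrite divr_gt0.
  have [|y [yd zy]] := hz (ball z (e / (1 + unitz_norm d))%:C).
    by apply: nbhsx_ballx; rewrite ltcR.
  move: zy; rewrite -ball_normE /= -rnormE ltcR ltr_pdivlMr// => zy.
  have -> : eact z d = eact (z - y) d by rewrite eactDl -scaleN1r eactZl yd scaler0 addr0.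
  apply: le_trans (rnorm_eact _ _) _; rewrite mulrC; apply: le_trans (ltW zy).
  by rewrite ler_wpM2l ?rnorm_ge0// lerDr.
- by rewrite /= /eact ract0l scaler0 addr0.
- by move=> l x y /= xd yd; rewrite eactDl eactZl xd yd scaler0 addr0.
Qed.

Lemma alg_lat_zero_product S : alg (lat (adjointable_operators E)) S ->
  forall x u v, u * v = 0 -> eact (S (eact x u)) v = 0.
Proof.
by move=> [_ hS] x u v uv; apply: (hS _ (annihilator_lat v)); rewrite /= -eactM uv eact0.
Qed.

(** [zero_product_balanced] for phi(c, d) = S(xc)d on the self-adjoint
    bicommutant of a. *)
Lemma alg_lat_commute_sa S x a : alg (lat (adjointable_operators E)) S ->
  cstar a = a -> S (ract x a) = ract (S x) a.
Proof.
move=> hS sa; pose u : unitz A := (a, 0); have uP := mem_own_sa_bicommutant sa.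
pose phi (c d : sa_alg u) := eact (S (eact x (val c))) (val d).
have [K K0 hK] := bounded_operatorP hS.1.
have := @zero_product_balanced R (sa_alg u) (@sa_cst R A u) (@sa_norm R A u)
  (sa_norm_is_function_norm u) E phi (K * rnorm x).
move=> /(_ _ _ _ _ (SaAlg uP)); rewrite /phi /= !eact1 !eact_alg; apply.
- by move=> c c' d; rewrite /= eactDr linearD eactDl.
- by move=> c d d'; rewrite /= eactDr.
- move=> c d; apply: le_trans (rnorm_eact _ _) _; rewrite mulrC.
  apply: ler_wpM2r; first exact: unitz_norm_ge0.
  by rewrite (le_trans (hK _))// -mulrA ler_wpM2l// mulrC rnorm_eact.
- move=> c d cd; apply: (alg_lat_zero_product hS).
  by have := congr1 val cd.
Qed.

Lemma alg_lat_sub_EndA : alg (lat (adjointable_operators E)) `<=` EndA E.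
Proof.
move=> S hS; split; first by case: hS.
move=> x a; pose f b := S (ract x b) - ract (S x) b.
have fD b c : f (b + c) = f b + f c.
  by rewrite /f !ractDr linearD opprD addrACA.
have fZ (l : R[i]) b : f (l *: b) = l *: f b.
  by rewrite /f !ractZr linearZ scalerBr.
have f0 b : cstar b = b -> f b = 0.
  by move=> sb; rewrite /f alg_lat_commute_sa ?subrr.
apply/subr0_eq; rewrite -/(f a).
(* Both a + a^* and c are self-adjoint, and 2a = (a + a^* ) - ic. *)
pose c := 'i%C *: (a - cstar a).
have fc : f c = 0.
  apply: f0; rewrite cstarZ cstarD cstarN cstarK /c.
  rewrite [X in X *: _](_ : _ = - 'i%C); last first.
    by apply/eqP; rewrite eq_complex /= oppr0 !eqxx.
  by rewrite scaleNr -scalerN opprB.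
have fs : f (a + cstar a) = 0 by apply: f0; rewrite cstarD cstarK addrC.
have : f (a + a) = 0.
  have -> : a + a = (a + cstar a) + (- 'i%C) *: c.
    rewrite scalerA mulNr -expr2 sqr_i opprK scale1r addrACA.
    by rewrite subrr addr0.
  by rewrite fD fZ fs fc scaler0 addr0.
rewrite fD -mulr2n -scaler_nat => /eqP; rewrite scaler_eq0 pnatr_eq0 /=.
by move/eqP.
Qed.

(** * Module maps leave lat L(E) invariant *)
Definition rank_one x y z : E := ract x (inner y z).

Lemma rank_one_is_linear x y : linear (rank_one x y).
Proof. by move=> l z w; rewrite /rank_one innerDr innerZr ractDr ractZr. Qed.

HB.instance Definition _ x y := GRing.isLinear.Build R[i] E E *:%R (rank_one x y)
  (rank_one_is_linear x y).

Lemma rank_one_adjointable x y : adjointable (rank_one x y).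
Proof.
move=> w; exists (rank_one y x w) => z.
by rewrite /rank_one inner_ractl inner_star inner_ract.
Qed.

(** With z = mg the difference is m(1 - gh^2), whose norm is |h(1 - gh^2)|. *)
Lemma ract_inner_approx m (eps : R) : 0 < eps ->
  exists z, rnorm (m - ract z (inner m m)) <= eps.
Proof.
move=> eps0; have [h [hs hh _]] := exists_inner_sqrt m.
pose u : unitz A := (h, 0); have uP := mem_own_sa_bicommutant hs.
have [g hg] := fnorm_sq_approx_unit (sa_norm_is_function_norm u) (SaAlg uP) eps0.
exists (eact m (val g)).
have uu : u * u = (inner m m, 0).
  by apply: unitz_eq; [rewrite /= !scale0r !addr0 | exact: mulr0].
have -> : m - ract (eact m (val g)) (inner m m) = eact m (1 - val g * (u * u)).
  by rewrite eactDr eactN eact1 eactM uu eact_alg.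
rewrite (rnorm_eact_sqrt _ hs hh).
apply: le_trans (rnorm_le_unitz_norm _) _.
have -> : (cact h (1 - val g * (u * u)), 0) = u * (1 - val g * (u * u)).
  by move: (1 - _) => w; apply: unitz_eq; rewrite /cact /= ?mul0r// scale0r addr0.
by move: hg; rewrite /sa_norm expr2.
Qed.

(** T maps z<m, m> to T(z)<m, m>, the image of m under a rank one operator, and
    m is a limit of vectors z<m, m>. *)
Lemma EndA_sub_alg_lat : EndA E `<=` alg (lat (adjointable_operators E)).
Proof.
move=> T [bT hT]; split=> // M [[cM M0 ML] aM] m Mm.
have [K K0 hK] := bounded_operatorP bT.
apply: (closed_approx cM) => e e0.
have K1 : 0 < K + 1 by rewrite ltr_wpDl.
have [z hz] := ract_inner_approx m (divr_gt0 e0 K1).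
exists (rank_one (T z) m m).
  exact: (aM (rank_one (T z) m) (@rank_one_adjointable (T z) m)).
rewrite /rank_one -hT -linearB; apply: le_lt_trans (hK _) _.
apply: le_lt_trans (ler_wpM2l K0 hz) _.
by rewrite mulrCA gtr_pMr// ltr_pdivrMr// mul1r ltrDl.
Qed.

Lemma alg_lat_adjointable : alg (lat (adjointable_operators E)) = EndA E.
Proof. by apply/seteqP; split; [exact: alg_lat_sub_EndA|exact: EndA_sub_alg_lat]. Qed.

Lemma EndA_unital_operator_algebra : unital_operator_algebra (EndA E).
Proof.
split.
- by move=> S [].
- by split=> //; exists 1 => x /=; rewrite mul1r.
- move=> S T [bS hS] [bT hT]; split=> [|x a]; last by rewrite /= hS hT ractDl.
  have [K K0 hK] := bounded_operatorP bS; have [L L0 hL] := bounded_operatorP bT.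
  apply: (@bounded_operator_of_rnorm _ _ _ (K + L)) => x /=.
  by rewrite mulrDl (le_trans (ler_rnormD _ _))// lerD.
- move=> l S [bS hS]; split=> [|x a]; last by rewrite /= hS ractZl.
  have [K K0 hK] := bounded_operatorP bS.
  apply: (@bounded_operator_of_rnorm _ _ _ (rnorm l * K)) => x /=.
  by rewrite rnormZ -mulrA ler_wpM2l// rnorm_ge0.
- move=> S T [bS hS] [bT hT]; split=> [|x a]; last by rewrite /= hT hS.
  have [K K0 hK] := bounded_operatorP bS; have [L L0 hL] := bounded_operatorP bT.
  apply: (@bounded_operator_of_rnorm _ _ _ (K * L)) => x /=.
  by rewrite (le_trans (hK _))// -mulrA ler_wpM2l.
Qed.

(** By [EndA_sub_alg_lat] every subspace in lat L(E) already belongs to lat of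
    End(E), so alg lat End(E) is contained in alg lat L(E). *)
Lemma EndA_reflexive : EndA E = alg (lat (EndA E)).
Proof.
apply/seteqP; split=> [S SE|S [bS hS]].
  by split=> [|M [_ hM]]; [case: SE|exact: hM].
apply: alg_lat_sub_EndA; split=> // M LM; apply: hS; split; first by case: LM.
by move=> T /EndA_sub_alg_lat[_]; exact.
Qed.

End HilbertModule.

Theorem theorem2p5 (R : realType) (A : cstarAlgType R)
    (E : hilbertCStarModType A) :
  alg (lat (adjointable_operators E)) = EndA E /\
  reflexive_operator_algebra (EndA E).
Proof.
split; first exact: alg_lat_adjointable.
by split; [exact: EndA_unital_operator_algebra|exact: EndA_reflexive].
Qed.
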